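(* For every positive integer $j$, \[ \sum_{n=0}^{\infty}p_{-6}\left(5^{j}n+\frac{3\cdot5^{j}+1}{4}\right)q^{n}=\sum_{l=1}^{\infty}b(j,l)\,q^{l-1}\frac{E_{5}^{6l}}{E_{1}^{6l+6}}. \]
   Context: $\sum_{n\geq0}p_{-6}(n)q^n=\prod_{i\geq1}(1-q^i)^{-6}$ ($6$-colored partitions), and $E_j:=\prod_{n\geq1}(1-q^{jn})$. The integers $m(i,j)$ ($i,j\geq1$) are defined by: $m(1,1)=5$, $m(2,1)=10$, $m(3,1)=9$, $m(4,1)=4$, $m(5,1)=1$, $m(i,1)=0$ for $i\geq6$; and for $j\geq2$, $i\geq1$, $m(i,j)=25m(i-1,j-1)+25m(i-2,j-1)+15m(i-3,j-1)+5m(i-4,j-1)+m(i-5,j-1)$, with $m(i',j')=0$ whenever $i'\leq0$. The integers $b(j,k)$ are defined by $b(1,1)=315$, $b(1,2)=52\cdot5^4$, $b(1,3)=63\cdot5^6$, $b(1,4)=6\cdot5^9$, $b(1,5)=5^{11}$, $b(1,k)=0$ for $k\geq6$, and $b(j+1,k)=\sum_{i\geq1}b(j,i)m(6i+6,k+i+1)$ for $j,k\geq1$. *)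

(* Defs.v *)
From HB Require Import structures.
From mathcomp Require Import all_boot all_order all_algebra.
From mathcomp Require Import boolp classical_sets functions cardinality fsbigop.

Set Implicit Arguments.
Unset Strict Implicit.
Unset Printing Implicit Defensive.

Import GRing.Theory.

Local Open Scope ring_scope.

(* Formal power series are wrapped in a record, rather than being an alias of
   [nat -> R], to keep the Cauchy product apart from the pointwise product
   that the library puts on function types. *)
Record fps (R : Type) := FPS { coef : nat -> R }.

Lemma fpsP (R : Type) (f g : fps R) : coef f =1 coef g <-> f = g.
Proof.
by split=> [|-> //]; case: f g => [f] [g] /= fg; congr FPS; apply/funext.
Qed.

HB.instance Definition _ (R : Type) := gen_eqMixin (fps R).
HB.instance Definition _ (R : Type) := gen_choiceMixin (fps R).

Section Zmodule.
Variable R : zmodType.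
Implicit Types f g h : fps R.

Definition fps0 : fps R := FPS (fun=> 0).
Definition fps_opp f := FPS (fun n => - coef f n).
Definition fps_add f g := FPS (fun n => coef f n + coef g n).

Fact fps_addA : associative fps_add.
Proof. by move=> f g h; apply/fpsP => n /=; rewrite addrA. Qed.
Fact fps_addC : commutative fps_add.
Proof. by move=> f g; apply/fpsP => n /=; rewrite addrC. Qed.
Fact fps_add0 : left_id fps0 fps_add.
Proof. by move=> f; apply/fpsP => n /=; rewrite add0r. Qed.
Fact fps_addN : left_inverse fps0 fps_opp fps_add.
Proof. by move=> f; apply/fpsP => n /=; rewrite addNr. Qed.

HB.instance Definition _ :=
  GRing.isZmodule.Build (fps R) fps_addA fps_addC fps_add0 fps_addN.

Lemma coef_fps0 n : coef (0 : fps R) n = 0. Proof. by []. Qed.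
Lemma coef_fpsD f g n : coef (f + g) n = coef f n + coef g n.
Proof. by []. Qed.
Lemma coef_fpsN f n : coef (- f) n = - coef f n. Proof. by []. Qed.
Lemma coef_fpsB f g n : coef (f - g) n = coef f n - coef g n.
Proof. by []. Qed.

End Zmodule.

Section ComRing.
Variable R : comNzRingType.
Implicit Types f g h : fps R.

Definition fps1 : fps R := FPS (fun n => (n == 0%N)%:R).
Definition fps_mul f g :=
  FPS (fun n => \sum_(i < n.+1) coef f i * coef g (n - i)%N).

Fact fps_mulC : commutative fps_mul.
Proof.
move=> f g; apply/fpsP => n /=.
rewrite (reindex_inj rev_ord_inj) /=; apply: eq_bigr => i _.
by rewrite mulrC subSS subKn // -ltnS.
Qed.

Let fps_mul_rev f g n :
  coef (fps_mul f g) n = \sum_(i < n.+1) coef f (n - i)%N * coef g i.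
Proof. by rewrite fps_mulC /=; apply: eq_bigr => i _; rewrite mulrC. Qed.

Fact fps_mulA : associative fps_mul.
Proof.
move=> f g h; apply/fpsP => n; rewrite [RHS]fps_mul_rev [LHS]/=.
pose F j k := coef f j * (coef g (n - j - k)%N * coef h k).
transitivity (\sum_(j < n.+1) \sum_(k < n.+1 | (k <= n - j)%N) F j k).
  apply: eq_bigr => /= j _.
  have /= -> := fps_mul_rev g h (n - j)%N.
  by rewrite big_distrr /= (big_ord_narrow_leq (leq_subr _ _)).
rewrite (exchange_big_dep predT) //=; apply: eq_bigr => k _.
transitivity (\sum_(j < n.+1 | (j <= n - k)%N) F j k).
  apply: eq_bigl => j; rewrite -ltnS -(ltnS j) -!subSn ?leq_ord //.
  by rewrite -subn_gt0 -(subn_gt0 j) -!subnDA addnC.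
rewrite (big_ord_narrow_leq (leq_subr _ _)) big_distrl /=.
by apply: eq_bigr => j _; rewrite /F -!subnDA addnC mulrA.
Qed.

Fact fps_mul1 : left_id fps1 fps_mul.
Proof.
move=> f; apply/fpsP => n /=; rewrite big_ord_recl /= mul1r subn0.
by rewrite big1 ?addr0 // => i _; rewrite mul0r.
Qed.

Fact fps_mulDl : left_distributive fps_mul +%R.
Proof.
move=> f g h; apply/fpsP => n /=; rewrite -big_split /=.
by apply: eq_bigr => i _; rewrite mulrDl.
Qed.

Fact fps1_neq0 : fps1 != 0.
Proof.
by apply/eqP => /(congr1 (fun f => coef f 0)) /eqP /=; rewrite oner_eq0.
Qed.

HB.instance Definition _ := GRing.Zmodule_isComNzRing.Build (fps R)
  fps_mulA fps_mulC fps_mul1 fps_mulDl fps1_neq0.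

Lemma coef_fps1 n : coef (1 : fps R) n = (n == 0%N)%:R. Proof. by []. Qed.
Lemma coef_fpsM f g n :
  coef (f * g) n = \sum_(i < n.+1) coef f i * coef g (n - i)%N.
Proof. by []. Qed.

Definition fpsX : fps R := FPS (fun n => (n == 1%N)%:R).

End ComRing.

Section UnitRing.
Variable R : comUnitRingType.
Implicit Types f g : fps R.

(* First [n.+1] coefficients of the inverse [g] of [f], from
   [f_0 * g_n = - \sum_(i < n) f_(n - i) * g_i]. *)
Fixpoint fps_inv_coefs f n : seq R :=
  if n is n'.+1 then
    let s := fps_inv_coefs f n' in
    rcons s (- (coef f 0)^-1 * \sum_(i < n'.+1) coef f (n'.+1 - i)%N * s`_i)
  else [:: (coef f 0)^-1].

Definition fps_unit : pred (fps R) := fun f => coef f 0 \is a GRing.unit.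
(* As required by [comUnitRingType], the inverse of a non-unit is itself. *)
Definition fps_inv f : fps R :=
  if fps_unit f then FPS (fun n => (fps_inv_coefs f n)`_n) else f.

Let size_inv f n : size (fps_inv_coefs f n) = n.+1.
Proof. by elim: n => //= n IHn; rewrite size_rcons IHn. Qed.

Let nth_inv f m n : (n <= m)%N ->
  (fps_inv_coefs f m)`_n = (fps_inv_coefs f n)`_n.
Proof.
elim: m => [|m IHm]; first by rewrite leqn0 => /eqP ->.
rewrite leq_eqVlt => /predU1P[-> //|nm].
by rewrite /= nth_rcons size_inv nm IHm.
Qed.

Fact fps_mulVf : {in fps_unit, left_inverse 1 fps_inv *%R}.
Proof.
move=> f uf; rewrite /fps_inv [fps_unit f]uf mulrC; apply/fpsP => n.
rewrite coef_fpsM coef_fps1 big_ord_recl subn0 /=.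
case: n => [|n]; first by rewrite big_ord0 addr0 /= divrr.
rewrite /= nth_rcons size_inv ltnn eqxx mulNr mulrN mulrA divrr // mul1r.
rewrite addrC; apply/eqP; rewrite subr_eq0; apply/eqP.
rewrite [RHS](reindex_inj rev_ord_inj) /=; apply: eq_bigr => i _.
have in_ : (i <= n)%N by rewrite -ltnS.
rewrite /bump leq0n add1n !subSS subSn ?leq_subr // subKn //.
by congr (_ * _); rewrite [RHS]nth_inv ?leq_subr.
Qed.

Fact fps_unitPl f g : g * f = 1 -> fps_unit f.
Proof.
move=> /(congr1 (fun h => coef h 0)); rewrite coef_fpsM big_ord1 subnn => gf1.
by apply/unitrPr; exists (coef g 0); rewrite mulrC.
Qed.

Fact fps_inv_out : {in [predC fps_unit], fps_inv =1 id}.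
Proof. by move=> f nuf; rewrite /fps_inv [fps_unit f](negbTE nuf). Qed.

HB.instance Definition _ := GRing.ComNzRing_hasMulInverse.Build (fps R)
  fps_mulVf fps_unitPl fps_inv_out.

Lemma fps_unitE f : (f \is a GRing.unit) = (coef f 0 \is a GRing.unit).
Proof. by []. Qed.

(* Convergence in the product topology of [nat -> R] with [R] discrete. *)
Definition fps_cvg (u : nat -> fps R) f :=
  forall n, exists N, forall M, (N <= M)%N -> coef (u M) n = coef f n.

Lemma fps_cvg_unique (u : nat -> fps R) f g :
  fps_cvg u f -> fps_cvg u g -> f = g.
Proof.
move=> uf ug; apply/fpsP => n; have [N1 H1] := uf n; have [N2 H2] := ug n.
by rewrite -(H1 (maxn N1 N2)) ?leq_maxl // H2 ?leq_maxr.
Qed.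

(* The limit is [0] by convention when [u] does not converge. *)
Definition fps_lim (u : nat -> fps R) : fps R := xget 0 [set f | fps_cvg u f].

Lemma fps_cvg_lim (u : nat -> fps R) f : fps_cvg u f -> fps_lim u = f.
Proof. by move=> uf; apply: xget_unique => // g /fps_cvg_unique; apply. Qed.

Definition fps_sum1 (F : nat -> fps R) :=
  fps_lim (fun N => \sum_(1 <= l < N.+1) F l).
Definition fps_prod1 (F : nat -> fps R) :=
  fps_lim (fun N => \prod_(1 <= i < N.+1) F i).

Lemma fps_lim_cvg d (u : nat -> fps R) :
  (forall N n, (n + d <= N)%N -> coef (u N.+1) n = coef (u N) n) ->
  fps_cvg u (fps_lim u).
Proof.
move=> uS; suff uf : fps_cvg u (FPS (fun n => coef (u (n + d)%N) n)).
  by rewrite (fps_cvg_lim uf).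
move=> n; exists (n + d)%N => M /subnK <-; elim: (M - _)%N => //= k IHk.
by rewrite addSn uS ?IHk // leq_addl.
Qed.

Lemma fps_sum1_cvg (F : nat -> fps R) :
  (forall l n, (n.+1 < l)%N -> coef (F l) n = 0) ->
  fps_cvg (fun N => \sum_(1 <= l < N.+1) F l) (fps_sum1 F).
Proof.
move=> F0; apply: (@fps_lim_cvg 1) => N n nN.
by rewrite big_nat_recr // coef_fpsD F0 ?addr0 // ltnS -addn1.
Qed.

Lemma fps_prod1_cvg (F : nat -> fps R) :
  (forall i n, (n < i)%N -> coef (F i) n = (n == 0%N)%:R) ->
  fps_cvg (fun N => \prod_(1 <= i < N.+1) F i) (fps_prod1 F).
Proof.
move=> F1; apply: (@fps_lim_cvg 0) => N n; rewrite addn0 => nN.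
have -> : \prod_(1 <= i < N.+2) F i = F N.+1 * \prod_(1 <= i < N.+1) F i.
  by rewrite big_nat_recr //= mulrC.
rewrite coef_fpsM big_ord_recl F1 // mul1r subn0 [X in _ + X]big1 ?addr0 // => i _.
by rewrite F1 ?mul0r // lift0 ltnS (leq_trans (ltn_ord i)).
Qed.

Lemma coef_fpsXn m n : coef (fpsX R ^+ m) n = (n == m)%:R.
Proof.
elim: m n => [|m IHm] n; first by rewrite expr0 coef_fps1.
rewrite exprS coef_fpsM; case: n => [|n]; first by rewrite big_ord1 mul0r.
rewrite 2!big_ord_recl /= mul0r add0r mul1r subSS subn0 IHm.
by rewrite big1 ?addr0 // => i _; rewrite mul0r.
Qed.

(* [coef f n = (n == 0)] for [n < N] means that [f = 1] modulo [q^N]. *)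
Lemma fps_one_modM f g N :
  (forall n, (n < N)%N -> coef f n = (n == 0%N)%:R) ->
  (forall n, (n < N)%N -> coef g n = (n == 0%N)%:R) ->
  forall n, (n < N)%N -> coef (f * g) n = (n == 0%N)%:R.
Proof.
move=> f1 g1 n nN; transitivity (coef ((1 : fps R) * 1) n); last by rewrite mulr1.
rewrite !coef_fpsM; apply: eq_bigr => i _.
by rewrite f1 ?g1 // (leq_ltn_trans _ nN) ?leq_subr // -ltnS.
Qed.

Lemma fps_one_modV f N : f \is a GRing.unit ->
  (forall n, (n < N)%N -> coef f n = (n == 0%N)%:R) ->
  forall n, (n < N)%N -> coef f^-1 n = (n == 0%N)%:R.
Proof.
move=> uf f1 n nN; transitivity (coef (f * f^-1) n); last by rewrite divrr.
rewrite -[f^-1 in LHS]mul1r !coef_fpsM; apply: eq_bigr => i _.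
by rewrite f1 // (leq_ltn_trans _ nN) // -ltnS.
Qed.

End UnitRing.

Notation "''q'" := (fpsX int) : ring_scope.

Definition E (j : nat) : fps int := fps_prod1 (fun n => 1 - 'q ^+ (j * n)).

Lemma E_cvg j : (0 < j)%N ->
  fps_cvg (fun N => \prod_(1 <= n < N.+1) (1 - 'q ^+ (j * n))) (E j).
Proof.
move=> j0; apply: fps_prod1_cvg => i n ni.
have nji : (n < j * i)%N by rewrite (leq_trans ni) // leq_pmull.
by rewrite coef_fpsB coef_fpsXn coef_fps1 (ltn_eqF nji) subr0.
Qed.

Lemma E_unit j : (0 < j)%N -> E j \is a GRing.unit.
Proof.
move=> j0; rewrite fps_unitE; have [N EN] := E_cvg j0 0; rewrite -(EN N) //.
rewrite -fps_unitE big_nat; apply: (big_ind (fun f => f \is a GRing.unit)) => [|f g uf ug|i /andP[i0 _]].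
- exact: unitr1.
- by rewrite unitrM uf.
- have ji0 : (0 < j * i)%N by rewrite muln_gt0 j0.
  by rewrite fps_unitE coef_fpsB coef_fpsXn coef_fps1 (ltn_eqF ji0) subr0 unitr1.
Qed.

Definition pm6_gf : fps int := fps_prod1 (fun i => (1 - 'q ^+ i) ^- 6).
Definition pm6 (n : nat) : int := coef pm6_gf n.

Lemma pm6_gf_cvg :
  fps_cvg (fun N => \prod_(1 <= i < N.+1) (1 - 'q ^+ i) ^- 6) pm6_gf.
Proof.
apply: fps_prod1_cvg => i n ni.
have f1 k : (k < i)%N -> coef (1 - 'q ^+ i) k = (k == 0%N)%:R.
  by move=> ki; rewrite coef_fpsB coef_fpsXn coef_fps1 (ltn_eqF ki) subr0.
apply: (fps_one_modV _ _ ni).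
  by rewrite unitrX // fps_unitE f1 ?unitr1 // (leq_ltn_trans _ ni).
elim: {1}6%N => [|m IHm] k ki; first by rewrite expr0 coef_fps1.
by rewrite exprS (fps_one_modM f1 IHm).
Qed.

(* The first index of [m] may be [<= 0] in the recurrence. Truncated
   subtraction sends all these indices to [0], where [m] vanishes. *)
Fixpoint m (i j : nat) {struct j} : int :=
  if i == 0%N then 0 else
  match j with
  | 0 => 0
  | 1 => match i with
         | 1 => 5 | 2 => 10 | 3 => 9 | 4 => 4 | 5 => 1 | _ => 0
         end
  | j'.+1 => 25 * m (i - 1) j' + 25 * m (i - 2) j' + 15 * m (i - 3) j'
             + 5 * m (i - 4) j' + m (i - 5) j'
  end.

(* The sum over [i >= 1] has finite support, because [m i j = 0] for
   [5 * j < i]. Only [j, k >= 1] is meaningful; [b 0 k] is a dummy value. *)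
Fixpoint b (j k : nat) {struct j} : int :=
  match j with
  | 0 => 0
  | 1 => match k with
         | 1 => 315
         | 2 => 52 * 5 ^+ 4
         | 3 => 63 * 5 ^+ 6
         | 4 => 6 * 5 ^+ 9
         | 5 => 5 ^+ 11
         | _ => 0
         end
  | j'.+1 => \sum_(i \in [set i : nat | (1 <= i)%N])
               b j' i * m (6 * i + 6) (k + i + 1)
  end.

(* Main.v *)
Require Import Defs.
From HB Require Import structures.
From mathcomp Require Import all_boot all_order all_algebra all_field.
From mathcomp Require Import classical_sets fsbigop.
From mathcomp Require Import ring zify.

Set Implicit Arguments.
Unset Strict Implicit.
Unset Printing Implicit Defensive.

Import Order.TTheory GRing.Theory Num.Theory.

Local Open Scope ring_scope.

(* The numbers [m i j] are the coefficients in powers of [tau = q E_5^6 / E_1^6]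
   of the zeroth 5-section [sum_n f_(5n) q^n] of [f = xi^i], where
   [xi = q E_25 / E_1]. By the pentagonal number theorem,
   [E_1 = a - q E_25 + q^2 c] with [a], [c] power series in [q^5]; as the exponents
   in Jacobi's expansion of [E_1^3] are triangular numbers, never 2 modulo 5,
   [a c = - E_25^2]. The product of the conjugates of [E_1] under
   [q |-> w q], [w^5 = 1], is [E_5^6 / E_25]; expanded with the dissection it
   becomes a quintic equation for [xi] over the series in [q^5], whose shape is
   that of the recurrence defining [m]. The initial sections are read off the
   dissection. The theorem follows by induction on [j], because extracting
   a residue class modulo 5 from [q^(l-1) E_5^(6l) / E_1^(6l+6)] amounts to
   taking the zeroth section of [xi^(6l+6)]. *)

(** * Congruence of power series modulo [q^N] *)

Section Congruence.
Variable R : comNzRingType.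
Implicit Types f g h : fps R.

Definition eqX N f g := forall n, (n < N)%N -> coef f n = coef g n.

Lemma eqX_sym N f g : eqX N f g -> eqX N g f.
Proof. by move=> fg n nN; rewrite fg. Qed.

Lemma eqX_trans N g f h : eqX N f g -> eqX N g h -> eqX N f h.
Proof. by move=> fg gh n nN; rewrite fg ?gh. Qed.

Lemma eqXW M N f g : (N <= M)%N -> eqX M f g -> eqX N f g.
Proof. by move=> NM fg n nN; apply/fg/(leq_trans nN). Qed.

Lemma eqXD N f g f' g' : eqX N f f' -> eqX N g g' -> eqX N (f + g) (f' + g').
Proof. by move=> ff gg n nN; rewrite !coef_fpsD ff ?gg. Qed.

Lemma eqXN N f g : eqX N f g -> eqX N (- f) (- g).
Proof. by move=> fg n nN; rewrite !coef_fpsN fg. Qed.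

Lemma eqXM N f g f' g' : eqX N f f' -> eqX N g g' -> eqX N (f * g) (f' * g').
Proof.
move=> ff gg n nN; rewrite !coef_fpsM; apply: eq_bigr => i _.
by rewrite ff ?gg // (leq_ltn_trans _ nN) ?leq_subr // -ltnS.
Qed.

Lemma eqX_exp N f g k : eqX N f g -> eqX N (f ^+ k) (g ^+ k).
Proof. by move=> fg; elim: k => // k IH; rewrite !exprS; apply: eqXM. Qed.

Lemma eqX_sum N (I : Type) (r : seq I) (P : pred I) (F G : I -> fps R) :
  (forall i, P i -> eqX N (F i) (G i)) ->
  eqX N (\sum_(i <- r | P i) F i) (\sum_(i <- r | P i) G i).
Proof.
move=> FG; apply: (big_ind2 (fun f g => eqX N f g)) => //.
by move=> f f' g g'; apply: eqXD.
Qed.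

Lemma eqX_sum0 N (I : Type) (r : seq I) (P : pred I) (F : I -> fps R) :
  (forall i, P i -> eqX N (F i) 0) -> eqX N (\sum_(i <- r | P i) F i) 0.
Proof.
move=> F0; apply: (big_ind (fun f => eqX N f 0)) => // f g f0 g0.
by rewrite -[0]addr0; apply: eqXD.
Qed.

Lemma eqX_prod N (I : Type) (r : seq I) (P : pred I) (F G : I -> fps R) :
  (forall i, P i -> eqX N (F i) (G i)) ->
  eqX N (\prod_(i <- r | P i) F i) (\prod_(i <- r | P i) G i).
Proof.
move=> FG; apply: (big_ind2 (fun f g => eqX N f g)) => //.
by move=> f f' g g'; apply: eqXM.
Qed.

Lemma eqX_all f g : (forall N, eqX N f g) -> f = g.
Proof. by move=> fg; apply/fpsP => n; apply: (fg n.+1). Qed.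

End Congruence.

(** * Sections modulo 5 and the dilation [q |-> q^5] *)

Section ScaledSubstitution.
Variable R : comUnitRingType.
Implicit Types f g h : fps R.

Lemma coef_fpsXnM k f n :
  coef (fpsX R ^+ k * f) n = if (n < k)%N then 0 else coef f (n - k)%N.
Proof.
rewrite coef_fpsM; case: ltnP => nk.
  rewrite big1 // => i _; rewrite coef_fpsXn ltn_eqF ?mul0r //.
  exact: leq_ltn_trans (leq_ord i) nk.
have kn : (k < n.+1)%N by rewrite ltnS.
rewrite (bigD1 (Ordinal kn)) //= coef_fpsXn eqxx mul1r big1 ?addr0 // => i ik.
by rewrite coef_fpsXn -val_eqE /= in ik *; rewrite (negbTE ik) mul0r.
Qed.

Lemma eqXnM N k f g : eqX N f g -> eqX (N + k) (fpsX R ^+ k * f) (fpsX R ^+ k * g).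
Proof.
move=> fg n nN; rewrite !coef_fpsXnM; case: ltnP => // kn; apply: fg; lia.
Qed.

Lemma eqXn0 N k f : (N <= k)%N -> eqX N (fpsX R ^+ k * f) 0.
Proof. by move=> Nk n nN; rewrite coef_fpsXnM (leq_trans nN). Qed.

Lemma fpsXnI k : injective (fun f => fpsX R ^+ k * f).
Proof.
move=> f g /(congr1 (@coef R)) fg; apply/fpsP => n.
move/(congr1 (fun u => u (n + k)%N)): fg.
by rewrite !coef_fpsXnM ltnNge leq_addl /= addnK.
Qed.

Lemma eqXV N f g : f \is a GRing.unit -> g \is a GRing.unit ->
  eqX N f g -> eqX N f^-1 g^-1.
Proof.
move=> uf ug fg; rewrite -[X in eqX _ X](divrK ug) -{2}[g^-1]mul1r.
rewrite -(mulVr uf) mulrAC; apply: eqXM => //; apply: eqXM => //.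
exact: eqX_sym.
Qed.

Definition sec5 r f : fps R := FPS (fun n => coef f (5 * n + r)%N).

Definition dil5 f : fps R :=
  FPS (fun n => if (5 %| n)%N then coef f (n %/ 5)%N else 0).

Lemma coef_sec5 r f n : coef (sec5 r f) n = coef f (5 * n + r).
Proof. by []. Qed.

Lemma sec5D r f g : sec5 r (f + g) = sec5 r f + sec5 r g.
Proof. by apply/fpsP. Qed.

Lemma sec5B r f g : sec5 r (f - g) = sec5 r f - sec5 r g.
Proof. by apply/fpsP. Qed.

Lemma sec5_0 r : sec5 r 0 = 0. Proof. by apply/fpsP. Qed.

Lemma sec5_sum r (I : Type) (s : seq I) (P : pred I) (F : I -> fps R) :
  sec5 r (\sum_(i <- s | P i) F i) = \sum_(i <- s | P i) sec5 r (F i).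
Proof. exact: (big_morph _ (sec5D r) (sec5_0 r)). Qed.

Lemma sec5_mulrn r f k : sec5 r (f *+ k) = sec5 r f *+ k.
Proof. by elim: k => [|k IH]; rewrite ?mulr0n ?sec5_0 // !mulrS sec5D IH. Qed.

Lemma sec5_eqX N r f g : eqX (5 * N + r) f g -> eqX N (sec5 r f) (sec5 r g).
Proof. by move=> fg n nN; apply: fg; lia. Qed.

Lemma sec5_ext f g : (forall r, (r < 5)%N -> sec5 r f = sec5 r g) -> f = g.
Proof.
move=> fg; apply/fpsP => n; have n5 : (n %% 5 < 5)%N by rewrite ltn_mod.
have /(congr1 (fun h => coef h (n %/ 5)%N)) /= := fg _ n5.
by rewrite mulnC -divn_eq.
Qed.

Lemma dil5_eqX N f g : eqX N f g -> eqX (5 * N) (dil5 f) (dil5 g).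
Proof. by move=> fg n nN /=; case: ifP => // _; apply: fg; lia. Qed.

Lemma sum_mult5 (F : nat -> R) n r : (r < 5)%N ->
  (forall i, ~~ (5 %| i)%N -> F i = 0) ->
  \sum_(i < (5 * n + r).+1) F i = \sum_(k < n.+1) F (5 * k)%N.
Proof.
move=> r5 F0; have F0' k s : (0 < s < 5)%N -> F (5 * k + s)%N = 0.
  by move=> s5; apply: F0; rewrite dvdn_addr ?dvdn_mulr // gtnNdvd //; lia.
have step k s : (s < 5)%N -> \sum_(i < (5 * k + s).+1) F i = \sum_(i < (5 * k).+1) F i.
  elim: s => [|s IH] s5; first by rewrite addn0.
  by rewrite addnS big_ord_recr /= IH ?(ltnW s5) // -addnS F0' ?addr0.
rewrite step //; elim: n => [|n IH]; first by rewrite !big_ord1.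
by rewrite big_ord_recr [RHS]big_ord_recr /= mulnSr -IH (addnS _ 4) step.
Qed.

(** Only the indices divisible by 5 of [dil5 f] contribute to the Cauchy product. Thus sections are
    linear over the series in [q^5], and such factors can be pulled out of them. *)
Lemma sec5_dil5M r f g : (r < 5)%N -> sec5 r (dil5 f * g) = f * sec5 r g.
Proof.
move=> r5; apply/fpsP => n; rewrite [LHS]/= coef_fpsM.
rewrite (sum_mult5 (F := fun i => coef (dil5 f) i * coef g (5 * n + r - i)%N)) //.
  apply: eq_bigr => k _; rewrite /= dvdn_mulr // mulKn //; congr (_ * coef g _).
  by have := leq_ord k; lia.
by move=> i /= /negbTE ->; rewrite mul0r.
Qed.

Lemma sec5_dil5 r f : (r < 5)%N -> sec5 r (dil5 f) = if r == 0%N then f else 0.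
Proof.
move=> r5; apply/fpsP => n /=; rewrite dvdn_addr ?dvdn_mulr //.
case: posnP => [->|r0]; first by rewrite addn0 mulKn.
by rewrite gtnNdvd.
Qed.

Fact dil5_zmod_morphism : zmod_morphism dil5.
Proof. by move=> f g; apply/fpsP => n /=; case: ifP => //; rewrite subr0. Qed.

Fact dil5_monoid_morphism : monoid_morphism dil5.
Proof.
split=> [|f g].
  apply/fpsP => n /=; case: ifP => [/dvdnP[k ->]|]; last by case: n.
  by rewrite mulnK // muln_eq0 orbF.
apply: sec5_ext => r r5; rewrite sec5_dil5M // !sec5_dil5 //.
by case: ifP => // _; rewrite mulr0.
Qed.

HB.instance Definition _ :=
  GRing.isZmodMorphism.Build (fps R) (fps R) dil5 dil5_zmod_morphism.
HB.instance Definition _ :=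
  GRing.isMonoidMorphism.Build (fps R) (fps R) dil5 dil5_monoid_morphism.

Lemma dil5X : dil5 (fpsX R) = fpsX R ^+ 5.
Proof.
apply: sec5_ext => r r5; rewrite sec5_dil5 //; apply/fpsP => n.
rewrite coef_sec5 coef_fpsXn; case: posnP => [->|r0] /=; last by case: eqP => //; lia.
by rewrite addn0 -{2}[5%N]muln1 eqn_mul2l.
Qed.

Lemma sec5_Xn r s f : (r < 5)%N -> (s < 5)%N ->
  sec5 r (fpsX R ^+ s * dil5 f) = if r == s then f else 0.
Proof.
move=> r5 s5; apply/fpsP => n; rewrite coef_sec5 coef_fpsXnM /=.
case: eqP => [->|/eqP rs]; first by rewrite ltnNge leq_addl /= addnK dvdn_mulr // mulKn.
case: ltnP => // h; case: ifP => //=.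
by move=> /dvdnP[k]; lia.
Qed.

Lemma dissect5 f : f = \sum_(r < 5) fpsX R ^+ r * dil5 (sec5 r f).
Proof.
apply: sec5_ext => r r5; rewrite sec5_sum (bigD1 (Ordinal r5)) //= sec5_Xn //.
rewrite eqxx big1 ?addr0 // => i ir; rewrite sec5_Xn //; case: eqP => // ri.
by rewrite -val_eqE /= ri eqxx in ir.
Qed.

Lemma sec5_XnM k r s f : (r < 5)%N -> (s < 5)%N ->
  sec5 r (fpsX R ^+ (5 * k + s) * f)
   = fpsX R ^+ k * sec5 r (fpsX R ^+ s * f).
Proof.
by move=> r5 s5; rewrite exprD exprM -dil5X -rmorphXn -mulrA sec5_dil5M.
Qed.

(** [5 n - s = 5 (n - 1) + (5 - s)]; at [n = 0] both sides vanish because [s > 0]. *)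
Lemma sec5_0_Xn s f : (0 < s < 5)%N ->
  sec5 0 (fpsX R ^+ s * f) = fpsX R * sec5 (5 - s) f.
Proof.
move=> s5; apply/fpsP => n; rewrite coef_sec5 -[fpsX R in RHS]expr1 !coef_fpsXnM.
case: n => [|n] /=; first by rewrite ifT //; lia.
by rewrite ifF; [congr coef; lia | lia].
Qed.

End ScaledSubstitution.

(** * Partial products of [E 1] and the generating function *)

Definition euler n : fps int := \prod_(1 <= i < n.+1) (1 - 'q ^+ i).

Lemma euler0 : euler 0 = 1. Proof. by rewrite /euler big_nil. Qed.

Lemma eulerS n : euler n.+1 = euler n * (1 - 'q ^+ n.+1).
Proof. by rewrite /euler big_nat_recr. Qed.

Lemma euler_unit n : euler n \is a GRing.unit.
Proof.
rewrite /euler big_nat; apply: rpred_prod => i /andP[i0 _].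
by rewrite fps_unitE coef_fpsB coef_fpsXn coef_fps1 (ltn_eqF i0) subr0 unitr1.
Qed.

Lemma eqX_euler m n : (m <= n)%N -> eqX m.+1 (euler n) (euler m).
Proof.
move=> /subnK <-; elim: (n - m)%N => //= k IH; rewrite addSn eulerS.
rewrite -[euler m]mulr1; apply: eqXM => // i im.
by rewrite coef_fpsB coef_fpsXn ltn_eqF ?subr0 //; lia.
Qed.

Lemma eqX_E1 n : eqX n.+1 (E 1) (euler n).
Proof.
move=> k kn; have [N EN] := E_cvg (ltn0Sn 0) k.
rewrite -(EN (maxn N n)) ?leq_maxl //.
rewrite -(eqX_euler (leq_maxr N n) kn).
by congr coef; apply: eq_bigr => i _; rewrite mul1n.
Qed.

Lemma E_mul5 j : (0 < j)%N -> E (5 * j) = dil5 (E j).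
Proof.
move=> j0; have j50 : (0 < 5 * j)%N by rewrite muln_gt0.
apply: fps_cvg_unique (E_cvg j50) _ => n.
have [N EN] := E_cvg j0 (n %/ 5)%N.
exists N => M NM; rewrite -[RHS]/(if _ then _ else _) -(EN M NM).
rewrite -[RHS]/(coef (dil5 _) n) rmorph_prod; congr coef; apply: eq_bigr => i _.
by rewrite rmorphB rmorph1 rmorphXn /= dil5X -exprM mulnA.
Qed.

Lemma pm6_gfE : pm6_gf = E 1 ^- 6.
Proof.
have eulerV n : \prod_(1 <= i < n.+1) (1 - 'q ^+ i) ^- 6 = euler n ^- 6.
  elim: n => [|n IH]; first by rewrite euler0 expr1n invr1 big_nil.
  have := euler_unit n.+1; rewrite eulerS unitrM => /andP[un uq].
  rewrite big_nat_recr //= IH exprMn [RHS]invrM ?unitrX //; exact: mulrC.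
apply: eqX_all => N n nN; have [M PM] := pm6_gf_cvg n.
rewrite -(PM (maxn M N)) ?leq_maxl // eulerV.
suff : eqX N (euler (maxn M N) ^- 6) (E 1 ^- 6) by apply.
apply: eqXV; rewrite ?unitrX ?euler_unit ?E_unit //; apply: eqX_exp.
apply: eqXW (leqW (leq_maxr M N)) _; exact: eqX_sym (@eqX_E1 _).
Qed.

(** * Euler's pentagonal number theorem *)

(** Triangular numbers. The combinations [s^2 + tri s = s (3 s + 1) / 2] and [(s + 1)^2 + tri s = (s
    + 1) (3 s + 2) / 2] are the generalized pentagonal numbers. *)
Definition tri s := 'C(s.+1, 2).

Lemma triS s : tri s.+1 = (tri s + s.+1)%N.
Proof. by rewrite /tri binS bin1. Qed.

Lemma tri_ge j : (j <= tri j)%N.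
Proof. by case: j => // j; rewrite triS leq_addl. Qed.

Lemma double_tri s : (2 * tri s = s * s.+1)%N.
Proof. by elim: s => // s IH; rewrite triS mulnDr IH -mulnDl addn2 mulnC. Qed.

Lemma tri_mul5D m r : tri (5 * m + r) = (25 * tri m + 5 * (m * r) + tri r - 10 * m)%N.
Proof.
have := double_tri m; have := double_tri r; have := double_tri (5 * m + r)%N.
nia.
Qed.

Section Shanks.
Variables (R : comNzRingType) (x : R).

(* Shanks' finite form of the pentagonal number theorem *)
Lemma shanks n :
  \sum_(s < n.+1) (-1) ^+ s * \prod_(s <= i < n) (1 - x ^+ i.+1) * x ^+ (s * n + tri s)
  = \sum_(s < n) (-1) ^+ s * (x ^+ (s ^ 2 + tri s) - x ^+ (s.+1 ^ 2 + tri s))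
    + (-1) ^+ n * x ^+ (n ^ 2 + tri n).
Proof.
elim: n => [|n IH]; first by rewrite big_ord1 big_ord0 add0r big_geq // [in LHS]mulr1.
rewrite big_ord_recr /= [X in _ * X * _]big_geq // mulr1 -mulnn; congr (_ + _).
rewrite [RHS]big_ord_recr /=.
(* Passing from [n] to [n + 1] changes summand [s] by [G (s - 1) - G s]. The change telescopes to
   [- G n], which is the new term on the right. *)
pose G s := (-1) ^+ s * \prod_(s <= i < n) (1 - x ^+ i.+1) * x ^+ (s.+1 * n.+1 + tri s).
have GE s : (s < n.+1)%N ->
    (-1) ^+ s * \prod_(s <= i < n.+1) (1 - x ^+ i.+1) * x ^+ (s * n.+1 + tri s)
    = (-1) ^+ s * \prod_(s <= i < n) (1 - x ^+ i.+1) * x ^+ (s * n + tri s)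
      + (if s is s'.+1 then G s' else 0) - G s.
  move=> sn; rewrite big_nat_recr //=; case: s sn => [|s] sn.
    by rewrite /G !mul0n !expr0 mul1n exprD; ring.
  rewrite /G [in RHS](big_ltn (m := s)) //.
  have -> : (s.+1 * n.+1 + tri s.+1 = s.+1 * n + tri s.+1 + s.+1)%N by lia.
  have -> : (s.+2 * n.+1 + tri s.+1 = s.+1 * n + tri s.+1 + s.+1 + n.+1)%N by lia.
  have -> : (s.+1 * n.+1 + tri s = s.+1 * n + tri s.+1)%N by rewrite triS; lia.
  by rewrite !exprD !exprS; ring.
rewrite (eq_bigr _ (fun s _ => GE _ (ltn_ord s))) big_split big_split /= IH.
rewrite [X in _ + _ + X + _ = _]big_ord_recl add0r sumrN [X in _ + _ - X]big_ord_recr /=.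
rewrite -!addrA; congr (_ + _); rewrite opprD [X in _ + X]addrA subrr add0r.
rewrite /G big_geq // mulr1 mulrBr; congr (_ + _).
Qed.

End Shanks.

(** In the left side of [shanks], only the summand [s = 0], which is [euler n], survives modulo
    [q^(n+1)]. The right side differs from the pentagonal sum by a multiple of [q^((n+1)^2)]. *)
Lemma eqX_pentagonal n :
  eqX n (E 1)
    (\sum_(s < n) (-1) ^+ s * ('q ^+ (s ^ 2 + tri s) - 'q ^+ (s.+1 ^ 2 + tri s))).
Proof.
case: n => // n; apply: eqX_trans (@eqX_E1 n) _; rewrite big_ord_recr /=.
have -> : euler n = euler n + 0 by rewrite addr0.
pose P := \sum_(s < n.+1) (-1) ^+ s * \prod_(s <= i < n) (1 - 'q ^+ i.+1)
            * 'q ^+ (s * n + tri s).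
apply: (@eqX_trans _ _ P).
  rewrite /P big_ord_recl /= !expr0 mul1r mulr1 /euler big_add1 /=; apply: eqXD => //.
  apply/eqX_sym/eqX_sum0 => i _; rewrite mulrC; apply: eqXn0.
  by rewrite /bump leq0n add1n triS mulSn; lia.
rewrite /P shanks mulrBr addrA -[X in eqX _ X]addr0; apply: eqXD => //.
apply: eqX_sym => k kn; rewrite coef_fpsN mulrC (@eqXn0 _ n.+1) ?oppr0 //.
by rewrite expnS; lia.
Qed.

Lemma dil5_Xn k r : 'q ^+ (5 * k + r) = 'q ^+ r * dil5 ('q ^+ k).
Proof. by rewrite addnC exprD exprM -dil5X -rmorphXn. Qed.

(** The indices [5 n + i], [i < 5], give ten exponents: four are 0 and four are 2 modulo 5. The
    other two are [1 + 25 p], with [p] the two pentagonal exponents of index [n]; hence the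
    self-similar middle term. *)
Lemma pentagonal_dissection n : exists A C : fps int,
  let S n := \sum_(s < n) (-1) ^+ s
               * ('q ^+ (s ^ 2 + tri s) - 'q ^+ (s.+1 ^ 2 + tri s)) in
  S (5 * n)%N = dil5 A - 'q * dil5 (dil5 (S n)) + 'q ^+ 2 * dil5 C.
Proof.
elim: n => [|n [A [C IH]]].
  by exists 0, 0; rewrite /= !big_ord0 !rmorph0 !mulr0 subr0 addr0.
pose e s := (s ^ 2 + tri s)%N.
have n_tri := tri_ge n.
have eE i : ((5 * n + i) ^ 2 + tri (5 * n + i)
    = 25 * e n + 15 * (n * i) + i ^ 2 + tri i - 10 * n)%N.
  by rewrite tri_mul5D /e -!mulnn; nia.
(* The exponents in the two witnesses are the quotients by 5 of those in residue classes 0 and 2.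
   The truncated subtraction is exact since [n <= tri n]. *)
exists (A + (-1) ^+ n * ('q ^+ (5 * e n - 2 * n) + 'q ^+ (5 * e n + 3 * n + 1)
                       - 'q ^+ (5 * e n + 7 * n + 3) - 'q ^+ (5 * e n + 12 * n + 7))).
exists (C + (-1) ^+ n * (- 'q ^+ (5 * e n + n) + 'q ^+ (5 * e n + 4 * n + 1)
                       - 'q ^+ (5 * e n + 6 * n + 2) + 'q ^+ (5 * e n + 9 * n + 4))).
have even_part i : ((5 * n + i).+1 ^ 2 + tri (5 * n + i)
    = 25 * e n + 15 * (n * i) + i.+1 ^ 2 + tri i)%N.
  by have := eE i; rewrite /e -!mulnn; lia.
have sign i : (-1) ^+ (5 * n + i) = (-1) ^+ n * (-1) ^+ i :> fps int.
  by rewrite exprD exprM -[in LHS]signr_odd expr1.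
have [t0 t1 t2 t3 t4] :
  [/\ tri 0 = 0, tri 1 = 1, tri 2 = 3, tri 3 = 6 & tri 4 = 10]%N by [].
have split5 (F : nat -> fps int) : \sum_(s < 5 * n.+1) F s
    = \sum_(s < 5 * n) F s + \sum_(i < 5) F (5 * n + i)%N.
  by rewrite mulnSr big_split_ord.
move: IH => /= IH.
rewrite (split5 (fun s => (-1) ^+ s
  * ('q ^+ (s ^ 2 + tri s) - 'q ^+ (s.+1 ^ 2 + tri s)))) {}IH.
under [X in _ + X]eq_bigr => i _ do rewrite sign even_part eE.
rewrite !big_ord_recr !big_ord0 /= -/(e n) t0 t1 t2 t3 t4.
have -> : (25 * e n + 15 * (n * 0) + 0 ^ 2 + 0 - 10 * n
  = 5 * (5 * e n - 2 * n) + 0)%N by lia.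
have -> : (25 * e n + 15 * (n * 0) + 1 ^ 2 + 0
  = 5 * (5 * e n) + 1)%N by lia.
have -> : (25 * e n + 15 * (n * 1) + 1 ^ 2 + 1 - 10 * n
  = 5 * (5 * e n + n) + 2)%N by lia.
have -> : (25 * e n + 15 * (n * 1) + 2 ^ 2 + 1
  = 5 * (5 * e n + 3 * n + 1) + 0)%N by lia.
have -> : (25 * e n + 15 * (n * 2) + 2 ^ 2 + 3 - 10 * n
  = 5 * (5 * e n + 4 * n + 1) + 2)%N by lia.
have -> : (25 * e n + 15 * (n * 2) + 3 ^ 2 + 3
  = 5 * (5 * e n + 6 * n + 2) + 2)%N by lia.
have -> : (25 * e n + 15 * (n * 3) + 3 ^ 2 + 6 - 10 * n
  = 5 * (5 * e n + 7 * n + 3) + 0)%N by lia.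
have -> : (25 * e n + 15 * (n * 3) + 4 ^ 2 + 6
  = 5 * (5 * e n + 9 * n + 4) + 2)%N by lia.
have -> : (25 * e n + 15 * (n * 4) + 4 ^ 2 + 10 - 10 * n
  = 5 * (5 * (n.+1 ^ 2 + tri n)) + 1)%N by rewrite /e -!mulnn; lia.
have -> : (25 * e n + 15 * (n * 4) + 5 ^ 2 + 10
  = 5 * (5 * e n + 12 * n + 7) + 0)%N by lia.
have dil5_X5 k : dil5 ('q ^+ (5 * k)) = dil5 (dil5 ('q ^+ k)).
  by rewrite exprM -dil5X -rmorphXn.
rewrite !dil5_Xn !(rmorphD, rmorphB, rmorphN, rmorphM, rmorph_sign) /= !dil5_X5 /e.
by ring.
Qed.

Lemma E1_dissection : exists A C : fps int,
  E 1 = dil5 A - 'q * E 25 + 'q ^+ 2 * dil5 C.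
Proof.
suff sec134 : [/\ sec5 1 (E 1) = - E 5, sec5 3 (E 1) = 0 & sec5 4 (E 1) = 0].
  have [e1 e3 e4] := sec134; exists (sec5 0 (E 1)), (sec5 2 (E 1)).
  rewrite {1}[E 1]dissect5 !big_ord_recr big_ord0 /= e1 e3 e4 (@E_mul5 5) //.
  by rewrite rmorphN !rmorph0 expr0 expr1; ring.
have E5 : E 5 = dil5 (E 1) by rewrite -E_mul5.
pose S n : fps int := \sum_(s < n) (-1) ^+ s
  * ('q ^+ (s ^ 2 + tri s) - 'q ^+ (s.+1 ^ 2 + tri s)).
have key n : [/\ eqX n (sec5 1 (E 1)) (- E 5), eqX n (sec5 3 (E 1)) 0
                & eqX n (sec5 4 (E 1)) 0].
  have [A [C /= AC]] := pentagonal_dissection n.+1; rewrite -!/(S _) in AC.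
  have secE r : (r < 5)%N -> eqX n (sec5 r (E 1)) (sec5 r (S (5 * n.+1)%N)).
    move=> r5; apply: sec5_eqX; apply: (eqXW _ (@eqX_pentagonal (5 * n.+1))).
    by rewrite mulnSr leq_add2l ltnW.
  have {AC}AC : S (5 * n.+1)%N = 'q ^+ 0 * dil5 A + 'q ^+ 1 * dil5 (- dil5 (S n.+1))
                  + 'q ^+ 2 * dil5 C.
    by rewrite AC rmorphN; ring.
  split; apply: (eqX_trans (secE _ _)) => //;
    rewrite AC !sec5D !sec5_Xn //= !(add0r, addr0) //.
  rewrite E5; apply: eqXN; apply: (@eqXW _ (5 * n.+1)); first by lia.
  exact/dil5_eqX/eqX_sym/eqX_pentagonal.
by split; apply: eqX_all => n; have [] := key n.
Qed.

(** * Jacobi's identity for the cube of [E 1] *)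

(* [1 / (q)_{k-1}], with the convention [1 / (q)_{-1} = 0]. *)
Definition rinv_euler k : fps int := if k is k'.+1 then (euler k')^-1 else 0.

Lemma rinv_eulerE k : rinv_euler k = rinv_euler k.+1 * (1 - 'q ^+ k).
Proof.
case: k => [|k]; first by rewrite expr0 subrr mulr0.
have := euler_unit k.+1; rewrite /= eulerS unitrM => /andP[u1 u2].
by rewrite invrM // -mulrA mulrC -mulrA divrr // mulr1.
Qed.

(** The [q]-Pascal rule applied twice: [[2n+3, k]] in terms of [[2n+1, k-1]], [[2n+1, k]] and
    [[2n+1, k-2]]. Once every [rinv_euler] is a multiple of those of highest index, it is a
    polynomial identity. *)
Lemma qbinom_rec n k l : (k + l.+2 = 2 * n + 4)%N ->
  euler (2 * n).+3 * rinv_euler k.+1 * rinv_euler l.+2 =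
  euler (2 * n).+1 * ((1 + 'q ^+ n.+1 ^+ 2) * rinv_euler k * rinv_euler l.+1
    + 'q ^+ k * rinv_euler k.+1 * rinv_euler l
    + 'q ^+ l.+1 * rinv_euler k.-1 * rinv_euler l.+2).
Proof.
move=> kl; rewrite !eulerS (rinv_eulerE l) (rinv_eulerE l.+1).
have -> : 'q ^+ l.+1 * rinv_euler k.-1
    = rinv_euler k.+1 * (1 - 'q ^+ k) * 'q ^+ l * ('q - 'q ^+ k).
  case: k {kl} => [|k]; first by rewrite !mulr0 expr0 subrr mulr0 !mul0r.
  by rewrite -pred_Sn (rinv_eulerE k) (rinv_eulerE k.+1) !exprS; ring.
rewrite (rinv_eulerE k) -exprM.
have -> : (n.+1 * 2 = k + l)%N by lia.
have -> : ((2 * n).+2 = k + l)%N by lia.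
by rewrite !exprS exprD; ring.
Qed.

(* [gauss n j] is the [q]-binomial coefficient [2n+1 choose n-j]. *)
Definition gauss n j := euler (2 * n).+1 * rinv_euler (n.+1 - j) * rinv_euler (n + 2 + j).

Lemma gauss_small n j : (n < j)%N -> gauss n j = 0.
Proof. by move=> nj; rewrite /gauss (_ : n.+1 - j = 0)%N ?mulr0 ?mul0r //; lia. Qed.

Definition jacobi_term n j : fps int := (-1) ^+ j * 'q ^+ tri j * gauss n j.

(** The recurrence of [jacobi_termS] at [j = -1]: by the symmetry [[2n+1, n+1] = [2n+1, n]], the
    term of index -1 would be [- jacobi_term n 0]. *)
Lemma jacobi_term0 n :
  jacobi_term n.+1 0 = (1 + 'q ^+ n.+1 ^+ 2) * jacobi_term n 0
                       + 'q ^+ n.+1 * (jacobi_term n 0 - jacobi_term n 1).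
Proof.
rewrite /jacobi_term /gauss !subn0 !addn0 (_ : 2 * n.+1 = (2 * n).+2)%N; last by lia.
rewrite !addn2 addn1 (@qbinom_rec n n.+1 n.+1); last by lia.
by rewrite subn1 /= -[tri 0]/0%N -[tri 1]/1%N !expr0 !expr1 !exprS; ring.
Qed.

(** The factor [q^(tri j)] absorbs the weights [q^k] and [q^(l+1)] of [qbinom_rec] at [k = n - j],
    [l = n + j + 2]. What remains is [q^(n+1)] for both neighbours, independently of [j]. *)
Lemma jacobi_termS n j : (j <= n)%N ->
  jacobi_term n.+1 j.+1 = (1 + 'q ^+ n.+1 ^+ 2) * jacobi_term n j.+1
                          - 'q ^+ n.+1 * (jacobi_term n j + jacobi_term n j.+2).
Proof.
move=> jn; rewrite /jacobi_term /gauss (_ : 2 * n.+1 = (2 * n).+2)%N; last by lia.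
have -> : (n.+2 - j.+1 = (n - j).+1)%N by lia.
have -> : (n.+1 + 2 + j.+1 = (n + j + 2).+2)%N by lia.
have -> : (n.+1 - j.+1 = n - j)%N by lia.
have -> : (n.+1 - j = (n - j).+1)%N by lia.
have -> : (n.+1 - j.+2 = (n - j).-1)%N by lia.
have -> : (n + 2 + j.+1 = (n + j + 2).+1)%N by lia.
have -> : (n + 2 + j.+2 = (n + j + 2).+2)%N by lia.
have -> : (n + 2 + j = n + j + 2)%N by lia.
rewrite !addn2 qbinom_rec; last by lia.
have q1 : 'q ^+ tri j.+1 * 'q ^+ (n - j) = 'q ^+ n.+1 * 'q ^+ tri j.
  by rewrite -!exprD triS; congr (_ ^+ _); lia.
have q2 : 'q ^+ tri j.+1 * 'q ^+ (n + j).+3 = 'q ^+ n.+1 * 'q ^+ tri j.+2.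
  by rewrite -!exprD (triS j.+1); congr (_ ^+ _); lia.
set y := 1 + _.
transitivity ((-1) ^+ j.+1 * euler (2 * n).+1 *
  ('q ^+ tri j.+1 * (y * rinv_euler (n - j) * rinv_euler (n + j).+3)
  + 'q ^+ tri j.+1 * 'q ^+ (n - j) * (rinv_euler (n - j).+1 * rinv_euler (n + j).+2)
  + 'q ^+ tri j.+1 * 'q ^+ (n + j).+3
    * (rinv_euler (n - j).-1 * rinv_euler (n + j).+4))).
  by ring.
by rewrite q1 q2 !exprS; ring.
Qed.

(* As [2 (2 j + 1) = (2 j + 3) + (2 j - 1)], the recurrence for [jacobi_term]
   mirrors [euler n.+1 ^+ 2 = euler n ^+ 2 * (1 + q^(2n+2) - 2 q^(n+1))]. *)
Lemma jacobi_finite n :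
  euler n ^+ 2 = \sum_(j < n.+1) jacobi_term n j *+ (2 * j).+1.
Proof.
elim: n => [|n IH].
  rewrite big_ord1 mulr1n -[jacobi_term 0 0]/(1 * 1 * (euler 1 / euler 0 / euler 1)).
  by rewrite euler0 expr1n divr1 divrr ?euler_unit // !mulr1.
pose d := jacobi_term n; pose d' := jacobi_term n.+1.
have d0 j : (n < j)%N -> d j = 0 by move=> nj; rewrite /d /jacobi_term gauss_small ?mulr0.
pose S := \sum_(j < n.+1) d j *+ (2 * j).+1.
(* The unweighted sum [A] enters [shift2] and [same] with opposite signs, so it cancels in [tail];
   the boundary terms [d 0] and [d 1] cancel against [jacobi_term0]. *)
pose A := \sum_(j < n.+1) d j.
have shift (G : nat -> fps int) : (forall j, (n < j)%N -> G j = 0) ->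
    \sum_(j < n.+1) G j.+1 = \sum_(j < n.+1) G j - G 0%N.
  move=> G0; rewrite big_ord_recr /= G0 // addr0 [in RHS]big_ord_recl /=.
  by rewrite addrAC subrr add0r.
have shift1 : \sum_(j < n.+1) d j.+1 *+ (2 * j.+1).+1 = S - d 0%N.
  by rewrite (shift (fun j => d j *+ (2 * j).+1)) // => j nj; rewrite d0 ?mul0rn.
have shift2 : \sum_(j < n.+1) d j.+2 *+ (2 * j.+1).+1 = S - A *+ 2 + d 0%N - d 1%N.
  rewrite (shift (fun j => d j.+1 *+ (2 * j).+1)) => [|j nj]; last first.
    by rewrite d0 ?mul0rn // ltnW.
  have -> : \sum_(j < n.+1) d j.+1 *+ (2 * j).+1
      = \sum_(j < n.+1) d j.+1 *+ (2 * j.+1).+1 - (\sum_(j < n.+1) d j.+1) *+ 2.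
    rewrite -sumrMnl -sumrB; apply: eq_bigr => j _.
    by rewrite (_ : (2 * j.+1).+1 = (2 * j).+1 + 2)%N ?mulrnDr ?addrK //; lia.
  by rewrite shift1 (shift d) // -/A !mulr2n muln0 mulr1n; ring.
have same : \sum_(j < n.+1) d j *+ (2 * j.+1).+1 = S + A *+ 2.
  rewrite /S /A -sumrMnl -big_split /=; apply: eq_bigr => j _.
  by rewrite -mulrnDr; congr (_ *+ _); lia.
have tail : \sum_(j < n.+1) jacobi_term n.+1 j.+1 *+ (2 * j.+1).+1
    = (1 + 'q ^+ n.+1 ^+ 2) * (S - d 0%N)
      - 'q ^+ n.+1 * (S + A *+ 2 + (S - A *+ 2 + d 0%N - d 1%N)).
  rewrite -shift1 -shift2 -same -big_split /= !mulr_sumr -sumrB.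
  apply: eq_bigr => j _; rewrite jacobi_termS -1?ltnS //.
  by rewrite -mulrnDl !mulrnAr mulrnBl.
rewrite eulerS exprMn IH -/S big_ord_recl /= mulr1n jacobi_term0 tail -/(d 0%N) -/(d 1%N).
by ring.
Qed.

(** Multiply [jacobi_finite] by [euler n]. As [euler n * gauss n j] is 1 modulo [q^(n-j+1)] and
    [j <= tri j], the factor [q^(tri j)] raises the precision to [q^(n+1)]. *)
Lemma eqX_jacobi n :
  eqX n.+1 (E 1 ^+ 3) (\sum_(j < n.+1) (-1) ^+ j * 'q ^+ tri j *+ (2 * j).+1).
Proof.
apply: (eqX_trans (eqX_exp 3 (@eqX_E1 n))); rewrite exprS jacobi_finite mulr_sumr.
apply: eqX_sum => j _; rewrite mulrnAr.
rewrite -[X in eqX _ X]mulr_natr -[X in eqX _ _ X]mulr_natr.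
apply: eqXM => //; rewrite /jacobi_term -mulrA mulrCA; apply: eqXM => //.
have jn : (j <= n)%N by rewrite -ltnS.
rewrite mulrCA -['q ^+ tri j in X in eqX _ _ X]mulr1.
apply: (@eqXW _ ((n - j).+1 + tri j)); first by have := tri_ge j; lia.
apply: eqXnM; rewrite /gauss (_ : n.+1 - j = (n - j).+1)%N ?subSn //=.
rewrite (_ : n + 2 + j = (n + j).+2)%N /=; last by lia.
have -> : 1 = euler (n - j) * (euler (n + j).+1 / euler (n - j) / euler (n + j).+1).
  by rewrite (mulrC (euler (n + j).+1)) !mulrA !divrr ?mul1r ?divrr ?euler_unit.
apply: eqXM; first by apply: eqX_euler; lia.
apply: eqXM => //; apply: eqXM => //.
by apply: (@eqXW _ (n + j).+2); [lia|apply: eqX_euler; lia].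
Qed.

Lemma tri_mod5 j : (tri j %% 5 \in [:: 0; 1; 3])%N.
Proof.
have := double_tri j.
rewrite {2 3}(divn_eq j 5); set k := (j %/ 5)%N; have : (j %% 5 < 5)%N by rewrite ltn_mod.
rewrite !inE; case: (j %% 5)%N => [|[|[|[|[|]]]]] // _ h; apply/or3P.
all: try by apply: Or31; apply/eqP; lia.
all: try by apply: Or32; apply/eqP; lia.
all: try by apply: Or33; apply/eqP; lia.
Qed.

Lemma sec5_E1_cube : sec5 2 (E 1 ^+ 3) = 0.
Proof.
have sec_tri j : sec5 2 ('q ^+ tri j) = 0.
  rewrite (divn_eq (tri j) 5) mulnC dil5_Xn sec5_Xn ?ltn_mod //.
  by have := tri_mod5 j; case: eqP => [<-|].
apply: eqX_all => n; apply: eqX_trans.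
  apply: sec5_eqX; apply: (eqXW _ (@eqX_jacobi (5 * n + 2))); exact: leqnSn.
rewrite sec5_sum big1 // => j _; rewrite sec5_mulrn -(rmorph_sign (@dil5 int)).
by rewrite sec5_dil5M // sec_tri mulr0 mul0rn.
Qed.

Lemma E1_dissection_prod : exists A C : fps int,
  [/\ A * C = - E 5 ^+ 2 & E 1 = dil5 A - 'q * E 25 + 'q ^+ 2 * dil5 C].
Proof.
have [A [C E1E]] := E1_dissection; exists A, C; split=> //.
have A0 : coef A 0 = 1.
  rewrite -[A](_ : sec5 0 (E 1) = A) ?coef_sec5; first by rewrite (@eqX_E1 0) ?euler0.
  rewrite E1E (@E_mul5 5) // sec5D sec5B sec5_dil5 // (@sec5_Xn _ 0 2) //=.
  by rewrite -['q]expr1 sec5_Xn //= subr0 addr0.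
have uA : A \is a GRing.unit by rewrite fps_unitE A0.
have := sec5_E1_cube; rewrite E1E (@E_mul5 5) // => h.
have {h} : A * ((A * C + E 5 ^+ 2) *+ 3) = 0.
  rewrite -[RHS]h.
  have -> : (dil5 A - 'q * dil5 (E 5) + 'q ^+ 2 * dil5 C) ^+ 3
    = 'q ^+ 0 * dil5 (A ^+ 3 - 'q * E 5 * C ^+ 2 *+ 3)
      + 'q ^+ 1 * dil5 ('q * C ^+ 3 - A ^+ 2 * E 5 *+ 3)
      + 'q ^+ 2 * dil5 (A * ((A * C + E 5 ^+ 2) *+ 3))
      + 'q ^+ 3 * dil5 (- E 5 ^+ 3 - A * E 5 * C *+ 6)
      + 'q ^+ 4 * dil5 (C * ((A * C + E 5 ^+ 2) *+ 3)).
    rewrite !(rmorphD, rmorphB, rmorphN, rmorphM, rmorphMn, rmorphXn) /= !dil5X.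
    by ring.
  by rewrite !sec5D !sec5_Xn //= !(add0r, addr0).
move=> /(congr1 (fun f => A^-1 * f)); rewrite mulr0 mulKr // => Z0.
apply/eqP; rewrite -addr_eq0; apply/eqP/fpsP => n.
have /(congr1 (fun f => coef f n)) := Z0.
by rewrite !mulrS mulr0n !coef_fpsD !coef_fps0; lia.
Qed.

(** * The product of the conjugates of [E 1] *)

Section Norm.
Variable R : comUnitRingType.
Implicit Types (f g : fps int) (w c : R).

(** The substitution [q |-> w q], with the coefficients mapped to [R]; [twist 1] is the bare change
    of coefficients. *)
Definition twist w f : fps R := FPS (fun n => (coef f n)%:~R * w ^+ n).

Fact twist_zmod_morphism w : zmod_morphism (twist w).
Proof. by move=> f g; apply/fpsP => n /=; rewrite rmorphB mulrBl. Qed.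

Fact twist_monoid_morphism w : monoid_morphism (twist w).
Proof.
split=> [|f g]; first by apply/fpsP => -[|n] /=; rewrite ?mulr1 // mul0r.
apply/fpsP => n; rewrite /= rmorph_sum mulr_suml; apply: eq_bigr => i _.
have -> : w ^+ n = w ^+ i * w ^+ (n - i) by rewrite -exprD subnKC // leq_ord.
by rewrite rmorphM mulrACA.
Qed.

HB.instance Definition _ w :=
  GRing.isZmodMorphism.Build (fps int) (fps R) (twist w) (@twist_zmod_morphism w).
HB.instance Definition _ w :=
  GRing.isMonoidMorphism.Build (fps int) (fps R) (twist w) (@twist_monoid_morphism w).

Definition fpsC c : fps R := FPS (fun n => if n == 0%N then c else 0).

Fact fpsC_zmod_morphism : zmod_morphism fpsC.
Proof. by move=> a b; apply/fpsP => -[|n] //=; rewrite subr0. Qed.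

Fact fpsC_monoid_morphism : monoid_morphism fpsC.
Proof.
split=> [|a b]; first by apply/fpsP => -[|n].
apply/fpsP => n; rewrite coef_fpsM big_ord_recl /= subn0 big1 ?addr0.
  by case: n => //= n; rewrite mulr0.
by move=> i _; rewrite mul0r.
Qed.

HB.instance Definition _ :=
  GRing.isZmodMorphism.Build R (fps R) fpsC fpsC_zmod_morphism.
HB.instance Definition _ :=
  GRing.isMonoidMorphism.Build R (fps R) fpsC fpsC_monoid_morphism.

Lemma twist_eqX N w f g : eqX N f g -> eqX N (twist w f) (twist w g).
Proof. by move=> fg n nN /=; rewrite fg. Qed.

Lemma twistX w : twist w 'q = fpsC w * twist 1 'q.
Proof.
apply/fpsP => n; rewrite coef_fpsM big_ord_recl /= subn0 big1 ?addr0 => [|i _].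
  by rewrite expr1n mulr1; case: eqP => [->|_]; rewrite ?mul1r ?mulr1 // mul0r mulr0.
by rewrite mul0r.
Qed.

Lemma twist_dil5 w f : w ^+ 5 = 1 -> twist w (dil5 f) = twist 1 (dil5 f).
Proof.
move=> w5; apply/fpsP => n /=; case: ifP => [/dvdnP[k ->]|_]; last by rewrite !mul0r.
by rewrite mulnC exprM w5 !expr1n.
Qed.

End Norm.

Lemma twist1_inj (R : numFieldType) : injective (@twist R 1).
Proof.
move=> f g /(congr1 (@coef R)) fg; apply/fpsP => n.
move/(congr1 (fun u => u n)): fg; rewrite /= expr1n !mulr1.
exact: intr_inj.
Qed.

Lemma prod_unity5 (R : comNzRingType) (v a b c : R) :
  1 + v + v ^+ 2 + v ^+ 3 + v ^+ 4 = 0 ->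
  \prod_(k < 5) (a + v ^+ k * b + v ^+ k ^+ 2 * c)
  = a ^+ 5 + b ^+ 5 + c ^+ 5 + 5 * a ^+ 2 * b * c ^+ 2 - 5 * a * b ^+ 3 * c.
Proof.
move=> v0; have v5 : v ^+ 5 = 1.
  by apply/eqP; rewrite -subr_eq0 -[X in _ == X](mulr0 (v - 1)) -v0; apply/eqP; ring.
rewrite !big_ord_recr big_ord0 /= -!exprM.
have -> : v ^+ (3 * 2) = v by rewrite (exprD v 5 1) v5 mul1r.
have -> : v ^+ (4 * 2) = v ^+ 3 by rewrite (exprD v 5 3) v5 mul1r.
(* The factors [k] and [5 - k] are multiplied first: their products involve [v] only through the
   periods [s] and [t], the roots of [X^2 + X - 1]. *)
pose s := v + v ^+ 4; pose t := v ^+ 2 + v ^+ 3.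
have sum_st : t = - 1 - s by apply/eqP; rewrite -subr_eq0 -v0 /s /t; apply/eqP; ring.
have prod_st : s * t = - 1.
  rewrite /s /t; transitivity (v ^+ 5 * (v + v ^+ 2) + v ^+ 3 + v ^+ 4); first by ring.
  by rewrite v5 -[RHS]addr0 -v0; ring.
have sqr_s : s ^+ 2 = 1 - s.
  transitivity (- s - s * (- 1 - s)); first by ring.
  by rewrite -sum_st prod_st; ring.
transitivity ((a + b + c) * (a ^+ 2 + b ^+ 2 + c ^+ 2 + s * (a * b + b * c) + t * (a * c))
   * (a ^+ 2 + b ^+ 2 + c ^+ 2 + t * (a * b + b * c) + s * (a * c))).
  have p14 : (a + v ^+ 1 * b + v ^+ (1 * 2) * c) * (a + v ^+ 4 * b + v ^+ 3 * c)
      = a ^+ 2 + b ^+ 2 + c ^+ 2 + s * (a * b + b * c) + t * (a * c).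
    transitivity (a ^+ 2 + v ^+ 5 * (b ^+ 2 + c ^+ 2) + (v + v ^+ 4) * (a * b)
      + (v ^+ 5 * v + v ^+ 4) * (b * c) + (v ^+ 2 + v ^+ 3) * (a * c)); first by ring.
    by rewrite v5 /s /t; ring.
  have p23 : (a + v ^+ 2 * b + v ^+ (2 * 2) * c) * (a + v ^+ 3 * b + v * c)
      = a ^+ 2 + b ^+ 2 + c ^+ 2 + t * (a * b + b * c) + s * (a * c).
    transitivity (a ^+ 2 + v ^+ 5 * (b ^+ 2 + c ^+ 2) + (v ^+ 2 + v ^+ 3) * (a * b)
      + (v ^+ 5 * v ^+ 2 + v ^+ 3) * (b * c) + (v + v ^+ 4) * (a * c)); first by ring.
    by rewrite v5 /s /t; ring.
  rewrite -p14 -p23; ring.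
rewrite sum_st.
set P := a ^+ 2 + _ + _; set X := a * b + _; set Y := a * c.
transitivity ((a + b + c) * (P ^+ 2 - P * X - P * Y - (s + s ^+ 2) * X ^+ 2
  - (s + s ^+ 2) * Y ^+ 2 + (1 + s *+ 2 + s ^+ 2 *+ 2) * X * Y)); first by ring.
by rewrite sqr_s /P /X /Y; ring.
Qed.

Section EulerNorm.
Variables (R : comUnitRingType) (w : R).
Hypothesis w5 : w ^+ 5 = 1.
Hypothesis w0 : 1 + w + w ^+ 2 + w ^+ 3 + w ^+ 4 = 0.

Definition norm5 f : fps R := \prod_(k < 5) twist (w ^+ k) f.

Lemma norm5M f g : norm5 (f * g) = norm5 f * norm5 g.
Proof. by rewrite /norm5 -big_split; apply: eq_bigr => k _; rewrite rmorphM. Qed.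

Lemma norm5_eqX N f g : eqX N f g -> eqX N (norm5 f) (norm5 g).
Proof. by move=> fg; apply: eqX_prod => k _; apply: twist_eqX. Qed.

Lemma twist_dil5_exp k f : twist (w ^+ k) (dil5 f) = twist 1 (dil5 f).
Proof. by rewrite twist_dil5 // exprAC w5 expr1n. Qed.

Lemma norm5_dil5 f : norm5 (dil5 f) = twist 1 (dil5 f) ^+ 5.
Proof.
rewrite /norm5 (eq_bigr (fun=> twist 1 (dil5 f))) => [|k _]; last exact: twist_dil5_exp.
by rewrite prodr_const card_ord.
Qed.

Lemma norm5_dissection A B C : norm5 (dil5 A + 'q * dil5 B + 'q ^+ 2 * dil5 C) =
  twist 1 (let a := dil5 A in let b := 'q * dil5 B in let c := 'q ^+ 2 * dil5 C in
    a ^+ 5 + b ^+ 5 + c ^+ 5 + 5 * a ^+ 2 * b * c ^+ 2 - 5 * a * b ^+ 3 * c).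
Proof.
have morph (a b c : fps int) : twist 1 (a ^+ 5 + b ^+ 5 + c ^+ 5
      + 5 * a ^+ 2 * b * c ^+ 2 - 5 * a * b ^+ 3 * c) =
    twist 1 a ^+ 5 + twist 1 b ^+ 5 + twist 1 c ^+ 5
      + 5 * twist 1 a ^+ 2 * twist 1 b * twist 1 c ^+ 2
      - 5 * twist 1 a * twist 1 b ^+ 3 * twist 1 c :> fps R.
  by rewrite !(rmorphD, rmorphN, rmorphXn, rmorphM, rmorph_nat) /=; ring.
rewrite /= morph -(@prod_unity5 _ (fpsC w)); last first.
  by rewrite -!rmorphXn -(rmorph1 (@fpsC R)) -!rmorphD w0 rmorph0.
rewrite /norm5; apply: eq_bigr => k _.
rewrite !(rmorphD, rmorphXn, rmorphM) /= !twist_dil5_exp (twistX (w ^+ k)) rmorphXn /=.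
by ring.
Qed.

(** For [n] prime to 5, [k |-> k n] permutes the residues modulo 5, so [w^n] satisfies the same
    relation as [w]. Then [prod_unity5] applies with [a = 1], [b = - q^n], [c = 0]. *)
Lemma norm5_1X n : ~~ (5 %| n)%N -> norm5 (1 - 'q ^+ n) = twist 1 (1 - 'q ^+ (5 * n)).
Proof.
move=> n5; rewrite /norm5.
transitivity (\prod_(k < 5) (1 + (fpsC w ^+ n) ^+ k * (- twist 1 ('q ^+ n))
                                + (fpsC w ^+ n) ^+ k ^+ 2 * 0)).
  apply: eq_bigr => k _; rewrite mulr0 addr0 rmorphB rmorph1 rmorphXn /= twistX.
  by rewrite exprMn rmorphXn mulrN -!exprM mulnC rmorphXn.
rewrite prod_unity5; first by rewrite rmorphB rmorph1 !rmorphXn /= mulnC exprM; ring.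
rewrite -!rmorphXn -(rmorph1 (@fpsC R)) -!rmorphD (_ : _ + _ = 0) ?rmorph0 //.
have := ltn_pmod n (isT : 0 < 5)%N; move: n5; rewrite /dvdn.
have -> : w ^+ n = w ^+ (n %% 5).
  by rewrite {1}(divn_eq n 5) exprD mulnC exprM w5 expr1n mul1r.
have w6 k : w ^+ (k + 5) = w ^+ k by rewrite exprD w5 mulr1.
case: (n %% 5)%N => [|[|[|[|[|]]]]] // _ _; rewrite -!exprM -[RHS]w0.
- by rewrite (w6 1%N) (w6 3%N); ring.
- by rewrite (w6 1%N) (w6 4%N) -[(3 * 4)%N]/(2 + 5 + 5)%N !w6; ring.
- rewrite (w6 3%N) -[(4 * 3)%N]/(2 + 5 + 5)%N -[(4 * 4)%N]/(1 + 5 + 5 + 5)%N !w6; ring.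
Qed.

(** A factor [1 - q^i] contributes [1 - q^(5i)] if 5 does not divide [i], and its fifth power
    otherwise. The second factor on the left supplies the [1 - q^(5i)] missing for [i] divisible by
    5. *)
Lemma norm5_euler n : norm5 (euler (5 * n)) * twist 1 (dil5 (dil5 (euler n))) =
  twist 1 (dil5 (euler (5 * n)) * dil5 (euler n) ^+ 5).
Proof.
have dil5_1X k : dil5 (1 - 'q ^+ k) = 1 - 'q ^+ (5 * k).
  by rewrite rmorphB rmorph1 rmorphXn /= dil5X exprM.
elim: n => [|n IH].
  rewrite !euler0 !rmorph1 expr1n /norm5 big1 ?mulr1 ?rmorph1 // => k _.
  by rewrite rmorph1.
have -> : (5 * n.+1 = (5 * n).+4.+1)%N by lia.
rewrite !eulerS !norm5M !(rmorphM (@dil5 int)) /=.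
have <- : dil5 (1 - 'q ^+ n.+1) = 1 - 'q ^+ (5 * n).+4.+1 :> fps int.
  by rewrite dil5_1X mulnSr !addnS addn0.
rewrite norm5_dil5 !norm5_1X -?dil5_1X; try lia.
set a := dil5 (1 - 'q ^+ n.+1); set b := dil5 (euler n).
move: IH; rewrite !(rmorphM, rmorphXn) /= => IH.
transitivity (norm5 (euler (5 * n)) * twist 1 (dil5 b) *
  (twist 1 (dil5 (1 - 'q ^+ (5 * n).+1)) * twist 1 (dil5 (1 - 'q ^+ (5 * n).+2))
  * twist 1 (dil5 (1 - 'q ^+ (5 * n).+3)) * twist 1 (dil5 (1 - 'q ^+ (5 * n).+4)))
  * twist 1 a ^+ 5 * twist 1 (dil5 a)).
  by ring.
by rewrite IH /b /=; ring.
Qed.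

Lemma norm5_E1 : norm5 (E 1) * twist 1 (E 25) = twist 1 (E 5 ^+ 6).
Proof.
have E5 : E 5 = dil5 (E 1) by rewrite -E_mul5.
rewrite exprS (@E_mul5 5) // !E5; apply: eqX_all => n.
have le_n : (n <= (5 * n).+1)%N by lia.
have eE1 : eqX n (E 1) (euler (5 * n)) by apply: eqXW le_n (@eqX_E1 _).
have eE5 m : (n <= m)%N -> eqX n (dil5 (E 1)) (dil5 (euler m)).
  by move=> nm; apply: (@eqXW _ (5 * m.+1)); [lia|apply/dil5_eqX/eqX_E1].
have eE25 : eqX n (dil5 (dil5 (E 1))) (dil5 (dil5 (euler n))).
  by apply: (@eqXW _ (5 * (5 * n.+1))); [lia|apply/dil5_eqX/dil5_eqX/eqX_E1].
apply: (@eqX_trans _ _ (norm5 (euler (5 * n)) * twist 1 (dil5 (dil5 (euler n))))).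
  by apply: eqXM; [apply: norm5_eqX|apply: twist_eqX].
rewrite norm5_euler; apply: eqX_sym; apply: twist_eqX; apply: eqXM.
  by apply: eE5; lia.
by apply: eqX_exp; apply: eE5.
Qed.

End EulerNorm.

(** With [y = q E_25], put [b = - y] and [a c = - y^2] in [norm5_dissection]: the coefficient -11 of
    [y^5] is [-1 - 5 - 5]. The fifth root of unity lives in [algC], and [twist1_inj] returns to
    integer coefficients. *)
Lemma E1_norm (A C : fps int) : A * C = - E 5 ^+ 2 ->
  E 1 = dil5 A - 'q * E 25 + 'q ^+ 2 * dil5 C ->
  (dil5 A ^+ 5 - 11 * ('q * E 25) ^+ 5 + ('q ^+ 2 * dil5 C) ^+ 5) * E 25 = E 5 ^+ 6.
Proof.
move=> AC E1E; have [w w_prim] := C_prim_root_exists (isT : (0 < 5)%N).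
have w5 := prim_expr_order w_prim.
have w0 : 1 + w + w ^+ 2 + w ^+ 3 + w ^+ 4 = 0.
  have wN1 : w - 1 != 0.
    rewrite subr_eq0; apply/eqP => w1; have := prim_order_dvd w_prim 1.
    by rewrite expr1 w1 eqxx.
  apply: (mulfI wN1); rewrite mulr0; transitivity (w ^+ 5 - 1); first by ring.
  by rewrite w5 subrr.
apply: (@twist1_inj algC); rewrite -(norm5_E1 w5 w0) rmorphM /=; congr (_ * _).
have {E1E} -> : E 1 = dil5 A + 'q * dil5 (- E 5) + 'q ^+ 2 * dil5 C.
  by rewrite E1E (@E_mul5 5) // rmorphN; ring.
rewrite norm5_dissection //=; congr twist.
have dAC : dil5 A * dil5 C = - E 25 ^+ 2.
  by rewrite -rmorphM AC rmorphN rmorphXn (@E_mul5 5).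
rewrite rmorphN /= -(@E_mul5 5) //; set a := dil5 A in dAC *; set c := dil5 C in dAC *.
transitivity (a ^+ 5 - ('q * E 25) ^+ 5 + ('q ^+ 2 * c) ^+ 5 + 
   5 * 'q ^+ 5 * E 25 * (a * c) * (E 25 ^+ 2 - a * c)); last by ring.
rewrite dAC; ring.
Qed.

(** In [E1_norm], [a^5 + c^5] is a polynomial in [a + c = E_1 + y] and [a c = - y^2]; expanded, it
    leaves no pure power [y^5]. *)
Lemma modular_equation (y := 'q * E 25) :
  (E 1 ^+ 5 + 5 * E 1 ^+ 4 * y + 15 * E 1 ^+ 3 * y ^+ 2 + 25 * E 1 ^+ 2 * y ^+ 3
     + 25 * E 1 * y ^+ 4) * E 25 = E 5 ^+ 6.
Proof.
have [A [C [AC E1E]]] := E1_dissection_prod.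
rewrite -(E1_norm AC E1E) E1E -/y; congr (_ * _).
have : dil5 A * ('q ^+ 2 * dil5 C) + y ^+ 2 = 0.
  by rewrite mulrCA -rmorphM AC rmorphN rmorphXn /= -(@E_mul5 5) // /y; ring.
move: (dil5 A) ('q ^+ 2 * dil5 C) y => a c z acz.
apply/eqP; rewrite -subr_eq0; apply/eqP.
(* The second factor is the quotient of the difference of the two sides by [a * c + z ^+ 2]. *)
transitivity ((a * c + z ^+ 2) * (5 * a ^+ 3 + 10 * a ^+ 2 * c + 5 * a * z ^+ 2
  + 10 * a * c ^+ 2 + 5 * z ^+ 2 * c + 5 * c ^+ 3)); first by ring.
by rewrite acz mul0r.
Qed.

(** * Zeroth sections of the powers of [xi] *)

Definition tau : fps int := 'q * E 5 ^+ 6 / E 1 ^+ 6.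

Definition xi : fps int := 'q * E 25 / E 1.

(** This is [modular_equation] divided by [E_1^5], because [dil5 tau = q^5 E_25^6 / E_5^6]. *)
Lemma xi_pow5 : xi ^+ 5 =
  dil5 tau * (25 * xi ^+ 4 + 25 * xi ^+ 3 + 15 * xi ^+ 2 + 5 * xi + 1).
Proof.
have u1 : E 1 \is a GRing.unit by rewrite E_unit.
have u5 : E 5 ^+ 6 \is a GRing.unit by rewrite unitrX ?E_unit.
have u15 : E 1 ^+ 5 \is a GRing.unit by rewrite unitrX.
have dE : dil5 tau * E 5 ^+ 6 = 'q ^+ 5 * E 25 ^+ 6.
  have E5 : E 5 = dil5 (E 1) by rewrite -E_mul5.
  rewrite E5 -rmorphXn -rmorphM /tau divrK ?unitrX //.
  by rewrite rmorphM rmorphXn /= dil5X -(@E_mul5 5).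
apply: (mulIr u15); apply: (mulIr u5).
have xiE : xi * E 1 = 'q * E 25 by rewrite divrK.
move: dE xiE modular_equation => /=.
move: (E 25) (E 5 ^+ 6) (E 1) xi (dil5 tau) 'q => e f g x t q dE xiE mE.
transitivity ((x * g) ^+ 5 * f); first by ring.
transitivity (t * f * (g ^+ 5 + 5 * g ^+ 4 * (x * g) + 15 * g ^+ 3 * (x * g) ^+ 2
    + 25 * g ^+ 2 * (x * g) ^+ 3 + 25 * g * (x * g) ^+ 4)); last by ring.
by rewrite xiE dE -mE; ring.
Qed.

(* [E 1 ^+ 4 * xi ^+ i] is [q^4 E_25^4 xi^(i-4)], so that these are, up to a
   factor, the zeroth sections of [xi^(-4), ..., xi^(-1)], written without
   negative powers of [q]. *)
Lemma sec5_4_E1_xi : [/\ sec5 4 (E 1 ^+ 4) = - E 5 ^+ 4 *+ 5,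
   sec5 4 (E 1 ^+ 4 * xi) = E 5 ^+ 4 *+ 5,
   sec5 4 (E 1 ^+ 4 * xi ^+ 2) = - E 5 ^+ 4,
   sec5 4 (E 1 ^+ 4 * xi ^+ 3) = - E 5 ^+ 4
 & forall i, sec5 4 (E 1 ^+ 4 * xi ^+ i.+4) = E 5 ^+ 4 * sec5 0 (xi ^+ i)].
Proof.
have [A [C [AC E1E]]] := E1_dissection_prod.
have u1 : E 1 \is a GRing.unit by rewrite E_unit.
have xiE : E 1 * xi = 'q * E 25 by rewrite mulrC divrK.
have E25 : E 25 = dil5 (E 5) by rewrite (@E_mul5 5).
have dAC : dil5 A * dil5 C = - dil5 (E 5) ^+ 2 by rewrite -rmorphM AC rmorphN rmorphXn.
(* The components given to [sec4] below collect the powers of [q] by residue modulo 5; each full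
   [q^5] becomes a ['q] inside [dil5]. *)
have sec4 (X0 X1 X2 X3 X4 : fps int) :
   sec5 4 ('q ^+ 0 * dil5 X0 + 'q ^+ 1 * dil5 X1 + 'q ^+ 2 * dil5 X2
     + 'q ^+ 3 * dil5 X3 + 'q ^+ 4 * dil5 X4) = X4.
  by rewrite !sec5D !sec5_Xn //= !(add0r, addr0).
have [xi1 xi2 xi3 xi4] : [/\ E 1 ^+ 4 * xi = E 1 ^+ 3 * ('q * E 25),
    E 1 ^+ 4 * xi ^+ 2 = E 1 ^+ 2 * ('q * E 25) ^+ 2,
    E 1 ^+ 4 * xi ^+ 3 = E 1 * ('q * E 25) ^+ 3
  & E 1 ^+ 4 * xi ^+ 4 = ('q * E 25) ^+ 4].
  by rewrite -xiE; move: (E 1) xi => f x; split; ring.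
have {}AC : E 5 ^+ 2 = - (A * C) by rewrite AC opprK.
split; last first.
- move=> i; rewrite -[i.+4]/(4 + i)%N exprD mulrA xi4 exprMn E25 -rmorphXn mulrAC mulrC.
  rewrite sec5_dil5M //; congr (_ * _).
  by apply/fpsP => n; rewrite !coef_sec5 coef_fpsXnM ltnNge leq_addl addnK addn0.
- rewrite xi3 E1E E25; move: (E 5) AC => e AC.
  rewrite -[RHS](sec4 ('q * C * e ^+ 3) 0 0 (A * e ^+ 3) (- e ^+ 4)); congr sec5.
  rewrite !(rmorph0, rmorphN, rmorphXn, rmorphM) /= !dil5X.
  by move: (dil5 A) (dil5 C) (dil5 e) 'q => a c f q; ring.
- rewrite xi2 E1E E25; move: (E 5) AC => e AC.
  have -> : - e ^+ 4 = (e ^+ 2 + A * C *+ 2) * e ^+ 2.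
    by rewrite -[4%N]/(2 + 2)%N exprD AC; ring.
  rewrite -[RHS](sec4 (- 'q * C * e ^+ 3 *+ 2) ('q * C ^+ 2 * e ^+ 2) (A ^+ 2 * e ^+ 2)
    (- A * e ^+ 3 *+ 2) _); congr sec5.
  rewrite !(rmorphD, rmorphN, rmorphMn, rmorphXn, rmorphM) /= !dil5X.
  by move: (dil5 A) (dil5 C) (dil5 e) 'q => a c f q; ring.
- rewrite xi1 E1E E25; move: (E 5) AC => e AC.
  have -> : e ^+ 4 *+ 5 = (- e ^+ 3 - A * e * C *+ 6) * e.
    rewrite -[4%N]/(2 + 2)%N exprD.
    by transitivity (e ^+ 2 * (- e ^+ 2 - A * C *+ 6)); [rewrite AC|]; ring.
  rewrite -[RHS](sec4 ('q * (A * C ^+ 2 + e ^+ 2 * C) * e *+ 3)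
     (A ^+ 3 * e - 'q * C ^+ 2 * e ^+ 2 *+ 3) ('q * C ^+ 3 * e - A ^+ 2 * e ^+ 2 *+ 3)
     ((A ^+ 2 * C + A * e ^+ 2) * e *+ 3) _); congr sec5.
  rewrite !(rmorphD, rmorphN, rmorphMn, rmorphXn, rmorphM) /= !dil5X.
  by move: (dil5 A) (dil5 C) (dil5 e) 'q => a c f q; ring.
- rewrite E1E E25; move: (E 5) AC => e AC.
  have -> : - e ^+ 4 *+ 5 = e ^+ 4 + A * e ^+ 2 * C *+ 12 + A ^+ 2 * C ^+ 2 *+ 6.
    by rewrite -[4%N]/(2 + 2)%N exprD AC; ring.
  rewrite -[RHS](sec4 (A ^+ 4 - 'q * (e ^+ 3 * C + A * e * C ^+ 2 *+ 3) *+ 4)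
    ('q * (e ^+ 2 * C ^+ 2 *+ 3 + A * C ^+ 3 *+ 2) *+ 2 - A ^+ 3 * e *+ 4)
    (A ^+ 3 * C *+ 4 + A ^+ 2 * e ^+ 2 *+ 6 - 'q * e * C ^+ 3 *+ 4)
    ('q * C ^+ 4 - A ^+ 2 * e * C *+ 12 - A * e ^+ 3 *+ 4) _); congr sec5.
  rewrite !(rmorphD, rmorphN, rmorphMn, rmorphXn, rmorphM) /= !dil5X.
  by move: (dil5 A) (dil5 C) (dil5 e) 'q => a c f q; ring.
Qed.

Lemma m0 j : m 0 j = 0. Proof. by case: j. Qed.

Lemma mSS n j : m n.+1 j.+2 = 25 * m n j.+1 + 25 * m (n - 1) j.+1
  + 15 * m (n - 2) j.+1 + 5 * m (n - 3) j.+1 + m (n - 4) j.+1.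
Proof. by rewrite [LHS]/= !subSS subn0. Qed.

Lemma m_small i j : (i < j)%N || (5 * j < i)%N -> m i j = 0.
Proof.
elim: j i => [|[|j] IH] i ij; first by case: (i).
  by case: i ij => [|[|[|[|[|[|i]]]]]].
case: i ij => [|i] ij; first exact: m0.
have IH' k : (k <= 4)%N -> m (i - k) j.+1 = 0.
  move=> k4; case: (leqP i k) => [ik|ki]; first by rewrite (_ : i - k = 0)%N ?m0 //; lia.
  by apply: IH; lia.
by rewrite mSS -{1}[i]subn0 !IH'.
Qed.

(** Since [m i j = 0] for [i < j], the truncation at [J] loses nothing once [i <= J]. *)
Definition msum J i : fps int := \sum_(j < J.+1) (m i j)%:~R * tau ^+ j.

Lemma msum0 J : msum J 0 = 0.
Proof. by rewrite /msum big1 // => j _; rewrite m0 mul0r. Qed.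

Lemma msum_recl J i : msum J i = \sum_(j < J) (m i j.+1)%:~R * tau ^+ j.+1.
Proof. by rewrite /msum big_ord_recl (_ : m i ord0 = 0) ?mul0r ?add0r //; case: i. Qed.

Lemma msumS J n : msum J.+1 n.+1 = (m n.+1 1)%:~R * tau
  + tau * (25 * msum J n + 25 * msum J (n - 1) + 15 * msum J (n - 2)
           + 5 * msum J (n - 3) + msum J (n - 4)).
Proof.
rewrite !msum_recl big_ord_recl; congr (_ + _).
rewrite !mulr_sumr -!big_split mulr_sumr; apply: eq_bigr => j _.
rewrite lift0 mSS (exprS _ j.+1); move: tau (tau ^+ _) (m n _) (m (n - 1) _)
  (m (n - 2) _) (m (n - 3) _) (m (n - 4) _) => t u c0 c1 c2 c3 c4.
by rewrite !(rmorphD, rmorphM, rmorph_nat) /=; ring.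
Qed.

(** Multiplied by [E_1^4 xi^i], the quintic for [xi] becomes a linear recurrence for the sections
    [W], since [dil5 tau] passes through them as [tau]. It is the recurrence of [m], started from
    [W 0, ..., W 4]. *)
Lemma sec5_0_xi n J : (0 < n <= J)%N -> sec5 0 (xi ^+ n) = msum J n.
Proof.
have [] := sec5_4_E1_xi; pose W i := sec5 4 (E 1 ^+ 4 * xi ^+ i).
rewrite -{1}[E 1 ^+ 4]mulr1 -[1]/(xi ^+ 0) -{1}[xi]expr1.
rewrite -/(W 0%N) -/(W 1%N) -/(W 2) -/(W 3).
move=> W0 W1 W2 W3 WS.
have rec i : W i.+1.+4 =
    tau * (25 * W i.+4 + 25 * W i.+3 + 15 * W i.+2 + 5 * W i.+1 + W i).
  have nat_dil (k : nat) : k%:R = dil5 k%:R :> fps int by rewrite rmorph_nat.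
  have sec_nat (k : nat) (f : fps int) : sec5 4 (k%:R * f) = k%:R * sec5 4 f.
    by rewrite {1}nat_dil sec5_dil5M.
  rewrite -!sec_nat -!sec5D -sec5_dil5M //; congr sec5.
  rewrite (_ : i.+1.+4 = i + 5)%N ?exprD ?xi_pow5; last by lia.
  rewrite !exprS; move: (E 1) xi (dil5 tau) (xi ^+ i) => f x t u; ring.
have W4 : W 4 = E 5 ^+ 4.
  by rewrite /W WS expr0 -(rmorph1 (@dil5 int)) sec5_dil5 // mulr1.
have ue : E 5 ^+ 4 \is a GRing.unit by rewrite unitrX ?E_unit.
move=> nJ; apply: (mulrI ue); rewrite -WS -/(W n.+4) {WS ue}; move: W0 W1 W2 W3 W4 rec.
move: W (E 5 ^+ 4) => W e W0 W1 W2 W3 W4 rec.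
elim/ltn_ind: n J nJ => -[|n] // IH [|J] // /andP[_ nJ].
rewrite rec msumS {rec}.
(* For exponents 1 to 5 the initial values contribute [m i 1 = 5, 10, 9, 4, 1]; the first is
   [25 - 25 - 15 + 25 - 5]. *)
case: n => [|[|[|[|[|n]]]]] in nJ IH *.
- rewrite W0 W1 W2 W3 W4 !msum0 /=; move: tau => t; ring.
- rewrite W1 W2 W3 W4 !(IH _ _ J) ?msum0 /=; try lia; move: (msum J) tau => u t; ring.
- rewrite W2 W3 W4 !(IH _ _ J) ?msum0 /=; try lia; move: (msum J) tau => u t; ring.
- rewrite W3 W4 !(IH _ _ J) ?msum0 /=; try lia; move: (msum J) tau => u t; ring.
- rewrite W4 !(IH _ _ J) ?msum0 /=; try lia; move: (msum J) tau => u t; ring.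
- rewrite !(IH _ _ J); try lia; rewrite !subSS !subn0 /= !mulr0z mul0r add0r.
  move: (msum J) tau => u t; ring.
Qed.

(** * Sections of the series in the expansion *)

Definition phi l : fps int := 'q ^+ (l - 1) * (E 5 ^+ (6 * l) / E 1 ^+ (6 * l + 6)).

Lemma tau_exp k i : tau ^+ (k + i + 2) =
  'q ^+ (i + 2) * E 5 ^+ (6 * i + 6) * (phi k.+1 / E 1 ^+ (6 * i)).
Proof.
have u1 : E 1 \is a GRing.unit by rewrite E_unit.
rewrite /tau /phi exprMn exprVn exprMn -!exprM.
have e1 : E 1 ^+ (6 * (k + i + 2)) = E 1 ^+ (6 * k.+1 + 6) * E 1 ^+ (6 * i).
  by rewrite -exprD; congr (_ ^+ _); lia.
have e5 : E 5 ^+ (6 * (k + i + 2)) = E 5 ^+ (6 * i + 6) * E 5 ^+ (6 * k.+1).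
  by rewrite -exprD; congr (_ ^+ _); lia.
have eq : 'q ^+ (k + i + 2) = 'q ^+ (i + 2) * 'q ^+ (k.+1 - 1) :> fps int.
  by rewrite -exprD; congr (_ ^+ _); lia.
rewrite e1 e5 eq invrM ?unitrX //.
move: (E 5 ^+ _) (E 5 ^+ _) ('q ^+ _) ('q ^+ _) (E 1 ^+ _)^-1 (E 1 ^+ _)^-1 => *.
ring.
Qed.

#[local] Arguments m : simpl never.
#[local] Arguments b : simpl never.

(** The terms with [j < i + 2] vanish because [5 j < 6 i + 6]; the others are indexed by
    [j = k + i + 2], where [tau_exp] isolates [phi k.+1]. *)
Lemma msum_phi K i : (5 * i + 5 <= K)%N -> msum (K + i + 1) (6 * i + 6) =
  'q ^+ (i + 2) * E 5 ^+ (6 * i + 6)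
  * ((\sum_(k < K) (m (6 * i + 6) (k.+1 + i + 1))%:~R * phi k.+1) / E 1 ^+ (6 * i)).
Proof.
move=> iK; rewrite /msum (_ : (K + i + 1).+1 = (i + 2) + K)%N; last by lia.
rewrite big_split_ord /= big1 ?add0r => [|j _]; last first.
  by rewrite m_small ?mul0r //; have := ltn_ord j; lia.
rewrite mulr_suml mulr_sumr; apply: eq_bigr => k _.
rewrite (_ : i + 2 + k = k + i + 2)%N; last by lia.
rewrite (_ : k.+1 + i + 1 = k + i + 2)%N; last by lia.
rewrite tau_exp; move: (m _ _)%:~R (phi _) => c p; rewrite mulrCA; congr (_ * _).
by rewrite mulrA.
Qed.

(** Common core of the initial case [i = 0] and the inductive case [i > 0]: the power of [E_25] is
    pulled out of the section of [xi^(6i+6)], and the common factors cancel. The bound on [K] makes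
    the expansion of this section complete. *)
Lemma sec5_0_phi i K (g : fps int) : (5 * i + 5 <= K)%N ->
  sec5 0 ('q ^+ (6 * i + 6) / E 1 ^+ (6 * i + 6)) = 'q ^+ (i + 2) * g ->
  E 1 ^+ (6 * i) * g = \sum_(k < K) (m (6 * i + 6) (k.+1 + i + 1))%:~R * phi k.+1.
Proof.
move=> iK gE; have u1 : E 1 \is a GRing.unit by rewrite E_unit.
have u5 : E 5 \is a GRing.unit by rewrite E_unit.
have : sec5 0 (xi ^+ (6 * i + 6)) = msum (K + i + 1) (6 * i + 6).
  by apply: sec5_0_xi; lia.
rewrite msum_phi // /xi exprMn exprVn exprMn (@E_mul5 5) // -rmorphXn mulrAC mulrC.
rewrite sec5_dil5M // gE mulrCA -mulrA => /fpsXnI.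
have uE5 := unitrX (6 * i + 6) u5; have uE1 := unitrX (6 * i) u1.
by move=> /(mulrI uE5) ->; rewrite mulrC divrK.
Qed.

(** [E_5^(6i)] is a series in [q^5], and [6 i + 6 = 5 (i + 1) + 2 + (i - 1)]. The shift by 2 turns
    section 3 into section 0, at the cost of one more factor [q]. *)
Lemma sec5_3_phi i K : (0 < i)%N -> (5 * i + 5 <= K)%N ->
  sec5 3 (phi i) = \sum_(k < K) (m (6 * i + 6) (k.+1 + i + 1))%:~R * phi k.+1.
Proof.
move=> i0 iK.
have -> : phi i = dil5 (E 1 ^+ (6 * i)) * ('q ^+ (i - 1) / E 1 ^+ (6 * i + 6)).
  by rewrite /phi rmorphXn /= -(@E_mul5 1) // mulrCA.
rewrite sec5_dil5M //; apply: sec5_0_phi => //.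
have -> : 'q ^+ (6 * i + 6) = 'q ^+ (5 * i.+1 + 2) * 'q ^+ (i - 1) :> fps int.
  by rewrite -exprD; congr (_ ^+ _); lia.
rewrite -mulrA sec5_XnM // sec5_0_Xn // mulrA -exprSr.
by rewrite addn2.
Qed.

Lemma sec5_4_pm6 K : (5 <= K)%N ->
  sec5 4 pm6_gf = \sum_(k < K) (m 6 (k.+1 + 1))%:~R * phi k.+1.
Proof.
move=> K5; transitivity (E 1 ^+ (6 * 0) * sec5 4 pm6_gf); first by rewrite mul1r.
rewrite (@sec5_0_phi 0 K) //; first by apply: eq_bigr => k _; rewrite addn0.
rewrite pm6_gfE -['q ^+ _]/('q ^+ (5 * 1 + 1)) sec5_XnM // sec5_0_Xn //.
by rewrite mulrA -exprSr.
Qed.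

(** The initial values of [b] are thus the instance [i = 0] of the coefficients in its
    recurrence. *)
Lemma b1E k : (k < 5)%N -> b 1 k.+1 = m 6 (k.+1 + 1).
Proof.
case: k => [|[|[|[|[|k]]]]] lt_k; last by exfalso; rewrite ltnNge in lt_k.
all: rewrite /b /m /=.
- ring.
- ring.
- ring.
- ring.
- ring.
Qed.

(** * Iteration *)

Lemma bSS j k B : (forall l, (B < l)%N -> b j.+1 l = 0) ->
  b j.+2 k = \sum_(i < B) b j.+1 i.+1 * m (6 * i.+1 + 6) (k + i.+1 + 1).
Proof.
move=> bB; rewrite -[LHS]/(\sum_(i \in [set i : nat | (1 <= i)%N]%classic)
  b j.+1 i * m (6 * i + 6) (k + i + 1)).
rewrite (fsbigE (index_iota 1 B.+1)) ?iota_uniq //; last 2 first.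
- by move=> i; rewrite /mkset /= mem_index_iota => /andP[].
- move=> i i1; rewrite mem_index_iota (i1 : (0 < i)%N) /= -leqNgt => Bi.
  by rewrite bB ?mul0r.
rewrite big_add1 big_mkord /=; apply: eq_bigl => i.
by rewrite mem_set.
Qed.

(** The bound [B] on the support of [b j] is carried through the induction, so that all sums stay
    finite. *)
Lemma b_phi j : (1 <= j)%N -> exists2 B, (forall l, (B < l)%N -> b j l = 0) &
  FPS (fun n : nat => pm6 (5 ^ j * n + (3 * 5 ^ j + 1) %/ 4)) =
  \sum_(l < B) (b j l.+1)%:~R * phi l.+1.
Proof.
case: j => // j _; elim: j => [|j [B bB IH]].
  exists 5; first by move=> [|[|[|[|[|[|l]]]]]].
  have -> : FPS (fun n => pm6 (5 ^ 1 * n + (3 * 5 ^ 1 + 1) %/ 4)) = sec5 4 pm6_gf.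
    by apply/fpsP.
  rewrite (@sec5_4_pm6 5) //; apply: eq_bigr => k _; congr (_%:~R * _).
  by rewrite b1E ?ltn_ord.
(* For [i <= B] and [l > 5 B + 5], one has [6 i + 6 < l + i + 1], so [m (6 * i + 6) (l + i + 1)]
   vanishes. *)
exists (5 * B + 5).
  move=> l Bl; rewrite (bSS _ bB) big1 // => i _; rewrite m_small ?mulr0 //.
  by have := ltn_ord i; lia.
have -> : FPS (fun n => pm6 (5 ^ j.+2 * n + (3 * 5 ^ j.+2 + 1) %/ 4))
    = sec5 3 (FPS (fun n => pm6 (5 ^ j.+1 * n + (3 * 5 ^ j.+1 + 1) %/ 4))).
  (* With [p = 5^(j+1)], the index is [p (5 n + 3) + (3 p + 1) / 4]; the divisions by 4 are exact
     since [p] is 1 modulo 4. *)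
  apply/fpsP => n; congr pm6.
  have : (5 ^ j.+1 = 1 %[mod 4])%N by rewrite -modnXm exp1n.
  rewrite (expnS 5 j.+1); move: (5 ^ j.+1)%N => p; lia.
have sec_int (c : int) (f : fps int) : sec5 3 (c%:~R * f) = c%:~R * sec5 3 f.
  have cE : c%:~R = dil5 c%:~R :> fps int by rewrite rmorph_int.
  by rewrite {1}cE sec5_dil5M.
rewrite IH sec5_sum; under eq_bigr => i _.
  rewrite sec_int (@sec5_3_phi _ (5 * B + 5)) //; last by have := ltn_ord i; lia.
  rewrite mulr_sumr; over.
rewrite exchange_big; apply: eq_bigr => k _ /=; rewrite (bSS _ bB) rmorph_sum mulr_suml.
by apply: eq_bigr => i _; rewrite /= rmorphM mulrA.
Qed.

Theorem theorem4p4 (j : nat) (hj : (1 <= j)%N) :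
  FPS (fun n : nat => pm6 (5 ^ j * n + (3 * 5 ^ j + 1) %/ 4)) =
  fps_sum1 (fun l : nat =>
    (b j l)%:~R * 'q ^+ (l - 1) * (E 5 ^+ (6 * l) / E 1 ^+ (6 * l + 6))).
Proof.
(* The partial sums are constant from [B] on, because [b j l] vanishes beyond [B]. *)
have [B bB ->] := b_phi hj; apply/esym/fps_cvg_lim => n; exists B => M BM.
congr coef; rewrite big_add1 big_mkord /=.
rewrite (big_ord_widen _ (fun l => (b j l.+1)%:~R * phi l.+1) BM) [RHS]big_mkcond.
apply: eq_bigr => l _; case: ltnP => [_|Bl]; first by rewrite -mulrA.
by rewrite bB // !mul0r.
Qed.
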